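(* Let $Q(\overline R,\overline R')$ be a generalized quantifier which is Henkin domain independent, Henkin conservative, and has strong existential import, all relative to $\Sigma^1_1\text{-}\mathsf{AC}_0^{\mathsf{wo}}$. Then $Q$ is bounded first-order definable relative to $\Sigma^1_1\text{-}\mathsf{AC}_0^{\mathsf{wo}}$.
   Context: Language: second-order logic with individual variables and, for each $n\ge1$, $n$-ary relation variables, identity, atomic formulas $R\overline x$, and one binary relation symbol $\preceq$ on individuals (no individual constants). The language is also taken to contain, as primitive symbols with their usual (first-order definable) meaning: $\emptyset,\subseteq,\cap,\cup,\setminus,\times$, $X^n$, projections $\pi_iR$, the field $\mathscr U R=\bigcup_i\pi_iR$, $\mathscr U\overline R=\bigcup_j\mathscr U R_j$ for tuples, and $R[\overline x]=\{\overline y:R\overline x\,\overline y\}$. For $n$-ary $R$ and unary $X$, $R\cap X:=X\cap R:=R\cap X^n$, and $\mathscr U\overline R\cap\overline R'$ is taken componentwise. A formula is first-order if it has no second-order quantifiers; it is $\Sigma^1_1$ if it is a block of existential second-order quantifiers followed by a first-order formula. Henkin model: $\mathcal A=(A,S_1[A],S_2[A],\ldots;\preceq^{\mathcal A})$ with $A\neq\emptyset$, $\emptyset\neq S_n[A]\subseteq P(A^n)$, $\preceq^{\mathcal A}\subseteq A^2$; $n$-ary relation variables range over $S_n[A]$; $R\overline a$ means $\overline a\in R$. Provability is many-sorted first-order provability, equivalently truth in all Henkin models of the theory. $\mathcal A$ is a substructure of $\mathcal B$ if $A\subseteq B$, $S_n[A]\subseteq S_n[B]$ for all $n$, and $\preceq^{\mathcal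 B}\cap A^2=\preceq^{\mathcal A}$. $\Sigma^1_1\text{-}\mathsf{AC}_0^{\mathsf{wo}}$ consists of: extensionality for each arity; comprehension $\exists R\,\forall\overline x\,(R\overline x\leftrightarrow\varphi(\overline x))$ for all first-order $\varphi$ (which may contain $\preceq$ and parameters; $R$ not free in $\varphi$); $\forall\overline x\,\exists R\,\varphi(\overline x,R)\rightarrow\exists R'\,\forall\overline x\,\varphi(\overline x,R'[\overline x])$ for $\Sigma^1_1$ formulas $\varphi$ (parameters allowed); and axioms saying $\preceq$ is a well-order of the individuals: reflexive, antisymmetric, transitive, linear, and $\forall X\,((\exists x\,Xx)\to\exists x_0\,(Xx_0\wedge\forall y\,(Xy\to x_0\preceq y)))$. A generalized quantifier is a formula whose only free variables are displayed second-order variables, here split into two non-empty tuples $\overline R,\overline R'$. Relative to a theory $T$: $Q$ is Henkin domain independent if for all Henkin models $\mathcal A,\mathcal B$ of $T$ with $\mathcal A$ a substructure of $\mathcal B$ and all arguments from the sets $S_{n}[A]$, $\mathcal A\models Q(\overline R,\overline R')$ iff $\mathcal B\models Q(\overline R,\overline R')$; Henkin conservative if $T$ proves $\forall\overline R\,\forall\overline R'\,(Q(\overline R,\overline R')\leftrightarrow Q(\overline R,\mathscr U\overline R\cap\overline R'))$; has strong existential import if $T$ proves $\forall\overline R\,\forall\overline R'\,(Q(\overline R,\overline R')\to\mathscr U\overline R\neq\emptyset)$ (and, if the signature had individual constants $c$, also $Q(\overline R,\overline R')\to(\mathscr U\overline R)c$). Binding: for a unary second-order term $X$ whose free variables are not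 bound in $\varphi$, $\varphi^X$ is obtained by restricting each first-order quantifier to elements of $X$ ($\exists x(Xx\wedge\cdots)$, $\forall x(Xx\to\cdots)$) and each $n$-ary second-order quantifier to subsets of $X^n$. $Q$ is bounded first-order definable relative to $T$ if there is a first-order formula $\Phi(\overline R,\overline R')$ with all free variables displayed such that $T$ proves $\forall\overline R\,\forall\overline R'\,(Q(\overline R,\overline R')\leftrightarrow\Phi^{\mathscr U\overline R}(\overline R,\overline R'))$. *)

(* Defs.v *)
From mathcomp Require Import all_boot.
From mathcomp Require Import boolp classical_sets.

Set Implicit Arguments.
Unset Strict Implicit.
Unset Printing Implicit Defensive.

Local Open Scope classical_set_scope.

(** Second-order logic with relation terms and one binary symbol [FLe] on
    individuals, under Henkin semantics.

    Variables are de Bruijn indices: the individual variables are [0, 1, ...],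
    and for every [n] there is a separate supply [0, 1, ...] of relation
    variables of arity [n.+1]; a quantifier over arity [n.+1] binds index [0] of
    that supply only.  Relation variables of arity 0 do not exist. *)

(** [(n, i)] is the relation variable number [i] of arity [n.+1]. *)
Definition rvar := (nat * nat)%type.

(* ------------------------------------------------------------------------ *)
(* Syntax                                                                   *)
(* ------------------------------------------------------------------------ *)

(** [rterm n] has no inhabitants for [n = 0]. *)
Inductive rterm : nat -> Type :=
| RVar (n i : nat) : rterm n.+1
| REmpty (n : nat) : rterm n.+1
| RCap (n : nat) : rterm n -> rterm n -> rterm n
| RCup (n : nat) : rterm n -> rterm n -> rterm n
| RDiff (n : nat) : rterm n -> rterm n -> rterm n
| RProd (m n : nat) : rterm m -> rterm n -> rterm (m + n)
| RPow (n : nat) : rterm 1 -> rterm n.+1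
| RProj (n : nat) : 'I_n -> rterm n -> rterm 1
| RField (n : nat) : rterm n -> rterm 1
| RSec (m n : nat) : rterm (m.+1 + n.+1) -> m.+1.-tuple nat -> rterm n.+1.

Inductive formula : Type :=
| FEq (x y : nat)
| FLe (x y : nat)
| FRel (n : nat) (t : rterm n) (xs : n.-tuple nat)
| FREq (n : nat) (t s : rterm n)
| FSub (n : nat) (t s : rterm n)
| FNot (phi : formula)
| FAnd (phi psi : formula)
| FEx1 (phi : formula)
| FEx2 (n : nat) (phi : formula). (* binds a variable of arity [n.+1] *)

Definition FImp phi psi := FNot (FAnd phi (FNot psi)).
Definition FIff phi psi := FAnd (FImp phi psi) (FImp psi phi).
Definition FAll1 phi := FNot (FEx1 (FNot phi)).
Definition FAll2 n phi := FNot (FEx2 n (FNot phi)).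

(** A block of [k] universal quantifiers, binding the variables [ivars k]. *)
Definition FAlls k phi := iter k FAll1 phi.
Definition ivars k : k.-tuple nat := [tuple nat_of_ord i | i < k].

Fixpoint first_order phi : bool :=
  match phi with
  | FNot p => first_order p
  | FAnd p q => first_order p && first_order q
  | FEx1 p => first_order p
  | FEx2 _ _ => false
  | _ => true
  end.

Fixpoint sigma11 phi : bool :=
  if phi is FEx2 _ p then sigma11 p else first_order phi.

(** Free variables. *)

Fixpoint tfree2 (v : rvar) n (t : rterm n) : bool :=
  match t with
  | RVar m i => v == (m, i)
  | REmpty _ => false
  | RCap _ t s | RCup _ t s | RDiff _ t s => tfree2 v t || tfree2 v s
  | RProd _ _ t s => tfree2 v t || tfree2 v s
  | RPow _ t | RProj _ _ t | RField _ t | RSec _ _ t _ => tfree2 v t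
  end.

Fixpoint tfree1 (x : nat) n (t : rterm n) : bool :=
  match t with
  | RVar _ _ | REmpty _ => false
  | RCap _ t s | RCup _ t s | RDiff _ t s => tfree1 x t || tfree1 x s
  | RProd _ _ t s => tfree1 x t || tfree1 x s
  | RPow _ t | RProj _ _ t | RField _ t => tfree1 x t
  | RSec _ _ t xs => tfree1 x t || (x \in tval xs)
  end.

(** Index seen from inside a binder for arity [n.+1] of the variable [(m, i)]. *)
Definition shift2 (n m i : nat) : nat := if m == n then i.+1 else i.

Fixpoint free2 (v : rvar) phi : bool :=
  match phi with
  | FEq _ _ | FLe _ _ => false
  | FRel _ t _ => tfree2 v t
  | FREq _ t s | FSub _ t s => tfree2 v t || tfree2 v s
  | FNot p => free2 v p
  | FAnd p q => free2 v p || free2 v q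
  | FEx1 p => free2 v p
  | FEx2 n p => free2 (v.1, shift2 n v.1 v.2) p
  end.

Fixpoint free1 (x : nat) phi : bool :=
  match phi with
  | FEq y z | FLe y z => (x == y) || (x == z)
  | FRel _ t xs => tfree1 x t || (x \in tval xs)
  | FREq _ t s | FSub _ t s => tfree1 x t || tfree1 x s
  | FNot p => free1 x p
  | FAnd p q => free1 x p || free1 x q
  | FEx1 p => free1 x.+1 p
  | FEx2 _ p => free1 x p
  end.

(** Capture-avoiding substitution of relation terms for relation variables. *)

(** [scons a e] is [a, e 0, e 1, ...]; [scons2 t f] does this to the variables of
    one arity.  Both serve for substitutions and for assignments. *)
Definition scons (T : Type) (a : T) (e : nat -> T) (x : nat) : T :=
  if x is y.+1 then e y else a.

Definition scons2 (T : nat -> Type) n (t : T n) (f : forall m, nat -> T m) :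
    forall m, nat -> T m :=
  @dfwith nat (fun m => nat -> T m) f n (scons t (f n)).

Definition rsubstitution := forall m : nat, nat -> rterm m.+1.

Fixpoint tren1 (rho : nat -> nat) n (t : rterm n) : rterm n :=
  match t with
  | RVar m i => RVar m i
  | REmpty m => REmpty m
  | RCap _ t s => RCap (tren1 rho t) (tren1 rho s)
  | RCup _ t s => RCup (tren1 rho t) (tren1 rho s)
  | RDiff _ t s => RDiff (tren1 rho t) (tren1 rho s)
  | RProd _ _ t s => RProd (tren1 rho t) (tren1 rho s)
  | RPow m t => RPow m (tren1 rho t)
  | RProj _ i t => RProj i (tren1 rho t)
  | RField _ t => RField (tren1 rho t)
  | RSec _ _ t xs => RSec (tren1 rho t) (map_tuple rho xs)
  end.

Fixpoint tsubst (sigma : rsubstitution) n (t : rterm n) : rterm n :=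
  match t with
  | RVar m i => sigma m i
  | REmpty m => REmpty m
  | RCap _ t s => RCap (tsubst sigma t) (tsubst sigma s)
  | RCup _ t s => RCup (tsubst sigma t) (tsubst sigma s)
  | RDiff _ t s => RDiff (tsubst sigma t) (tsubst sigma s)
  | RProd _ _ t s => RProd (tsubst sigma t) (tsubst sigma s)
  | RPow m t => RPow m (tsubst sigma t)
  | RProj _ i t => RProj i (tsubst sigma t)
  | RField _ t => RField (tsubst sigma t)
  | RSec _ _ t xs => RSec (tsubst sigma t) xs
  end.

Definition lift2 (n : nat) : rsubstitution :=
  fun m i => RVar m (shift2 n m i).

Fixpoint fsubst (sigma : rsubstitution) phi : formula :=
  match phi with
  | FEq x y => FEq x y
  | FLe x y => FLe x y
  | FRel _ t xs => FRel (tsubst sigma t) xs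
  | FREq _ t s => FREq (tsubst sigma t) (tsubst sigma s)
  | FSub _ t s => FSub (tsubst sigma t) (tsubst sigma s)
  | FNot p => FNot (fsubst sigma p)
  | FAnd p q => FAnd (fsubst sigma p) (fsubst sigma q)
  | FEx1 p => FEx1 (fsubst (fun m i => tren1 succn (sigma m i)) p)
  | FEx2 n p =>
      FEx2 n (fsubst (@scons2 (fun m => rterm m.+1) n (RVar n 0)
                        (fun m i => tsubst (lift2 n) (sigma m i))) p)
  end.

(** [relativize X phi] is phi^X; [X] is adjusted at each binder, so that none of
    its variables is captured. *)
Fixpoint relativize (X : rterm 1) phi : formula :=
  match phi with
  | FNot p => FNot (relativize X p)
  | FAnd p q => FAnd (relativize X p) (relativize X q)
  | FEx1 p =>
      let X' := tren1 succn X in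
      FEx1 (FAnd (FRel X' [tuple 0]) (relativize X' p))
  | FEx2 n p =>
      let X' := tsubst (lift2 n) X in
      FEx2 n (FAnd (FSub (RVar n 0) (RPow n X')) (relativize X' p))
  | _ => phi
  end.

(* ------------------------------------------------------------------------ *)
(* Henkin semantics                                                         *)
(* ------------------------------------------------------------------------ *)

(** Henkin models whose domain is a subset of an ambient type [U], so that being
    a substructure is literal inclusion.  [hrel M n] is the range of the relation
    variables of arity [n.+1]. *)
Record henkin (U : Type) := Henkin {
  hdom : set U;
  hrel : forall n : nat, set (set (n.+1.-tuple U));
  hle : U -> U -> Prop;
  hdom_nonempty : hdom !=set0;
  hrel_nonempty : forall n, @hrel n !=set0;
  hrel_sub : forall n (X : set (n.+1.-tuple U)), hrel X ->
    forall (t : n.+1.-tuple U), X t -> forall i, hdom (tnth t i);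
  hle_sub : forall x y, hle x y -> hdom x /\ hdom y
}.
Arguments hrel {U} _ n _.

Definition rassignment (U : Type) := forall n : nat, nat -> set (n.+1.-tuple U).

Definition assignment_in U (M : henkin U) (e : nat -> U) (r : rassignment U) :=
  (forall x, hdom M (e x)) /\ (forall n i, hrel M n (r n i)).

Fixpoint teval U (e : nat -> U) (r : rassignment U) n (t : rterm n) :
    set (n.-tuple U) :=
  match t with
  | RVar m i => r m i
  | REmpty _ => set0
  | RCap _ t s => teval e r t `&` teval e r s
  | RCup _ t s => teval e r t `|` teval e r s
  | RDiff _ t s => teval e r t `\` teval e r s
  | RProd _ _ t s =>
      [set u | exists a b,
        [/\ teval e r t a, teval e r s b & u = cat_tuple a b]]
  | RPow _ t => [set u | forall i, teval e r t [tuple tnth u i]]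
  | RProj _ i t => [set u | exists2 a, teval e r t a & thead u = tnth a i]
  | RField _ t =>
      [set u | exists i, exists2 a, teval e r t a & thead u = tnth a i]
  | RSec _ _ t xs => [set u | teval e r t (cat_tuple (map_tuple e xs) u)]
  end.

Fixpoint sat U (M : henkin U) (e : nat -> U) (r : rassignment U) phi : Prop :=
  match phi with
  | FEq x y => e x = e y
  | FLe x y => hle M (e x) (e y)
  | FRel _ t xs => teval e r t (map_tuple e xs)
  | FREq _ t s => teval e r t = teval e r s
  | FSub _ t s => teval e r t `<=` teval e r s
  | FNot p => ~ sat M e r p
  | FAnd p q => sat M e r p /\ sat M e r q
  | FEx1 p => exists2 a, hdom M a & sat M (scons a e) r p
  | FEx2 n p =>
      exists2 X, hrel M n X
      & sat M e (@scons2 (fun m => set (m.+1.-tuple U)) n X r) p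
  end.

(** A formula holds in a model if its universal closure does. *)
Definition holds U (M : henkin U) phi :=
  forall e r, assignment_in M e r -> sat M e r phi.

Definition theory := formula -> Prop.

Definition is_model U (M : henkin U) (T : theory) :=
  forall phi, T phi -> holds M phi.

(** Provability (of the universal closure), as truth in all Henkin models. *)
Definition provable (T : theory) phi :=
  forall (U : Type) (M : henkin U), is_model M T -> holds M phi.

Definition substructure U (M N : henkin U) :=
  [/\ hdom M `<=` hdom N,
      forall n, hrel M n `<=` hrel N n
    & forall x y, [/\ hle N x y, hdom M x & hdom M y] <-> hle M x y].

(* ------------------------------------------------------------------------ *)
(* The theory Sigma^1_1-AC_0^wo                                             *)
(* ------------------------------------------------------------------------ *)

Inductive Sigma11_AC0_wo : theory :=
| ax_ext n : Sigma11_AC0_wo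
    (FAll2 n (FAll2 n (FImp
       (FAlls n.+1 (FIff (FRel (RVar n 1) (ivars n.+1))
                         (FRel (RVar n 0) (ivars n.+1))))
       (FREq (RVar n 1) (RVar n 0)))))
(* The lifting expresses that the relation variable is not free in [phi]. *)
| ax_comprehension n phi : first_order phi -> Sigma11_AC0_wo
    (FEx2 n (FAlls n.+1
       (FIff (FRel (RVar n 0) (ivars n.+1)) (fsubst (lift2 n) phi))))
(* [phi] has individual variables [ivars m.+1] and relation variable [(n, 0)];
   the arity of the choice relation [(m + n.+1, 0)] is [m.+1 + n.+1]. *)
| ax_choice m n phi : sigma11 phi -> Sigma11_AC0_wo
    (FImp
       (FAlls m.+1 (FEx2 n phi))
       (FEx2 (m + n.+1) (FAlls m.+1 (fsubst
          (@scons2 (fun k => rterm k.+1) n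
             (@RSec m n (RVar (m + n.+1) 0) (ivars m.+1))
             (lift2 (m + n.+1)))
          phi))))
| ax_le_refl : Sigma11_AC0_wo (FAll1 (FLe 0 0))
| ax_le_antisym : Sigma11_AC0_wo
    (FAll1 (FAll1 (FImp (FAnd (FLe 1 0) (FLe 0 1)) (FEq 1 0))))
| ax_le_trans : Sigma11_AC0_wo
    (FAll1 (FAll1 (FAll1 (FImp (FAnd (FLe 2 1) (FLe 1 0)) (FLe 2 0)))))
| ax_le_total : Sigma11_AC0_wo
    (FAll1 (FAll1 (FImp (FNot (FLe 1 0)) (FLe 0 1))))
| ax_le_least : Sigma11_AC0_wo
    (FAll2 0 (FImp
       (FEx1 (FRel (RVar 0 0) [tuple 0]))
       (FEx1 (FAnd (FRel (RVar 0 0) [tuple 0])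
          (FAll1 (FImp (FRel (RVar 0 0) [tuple 0]) (FLe 1 0))))))).

(* ------------------------------------------------------------------------ *)
(* Generalized quantifiers                                                  *)
(* ------------------------------------------------------------------------ *)

(** All free variables of [phi] are relation variables from [vs]. *)
Definition displayed (vs : seq rvar) phi :=
  (forall x, ~~ free1 x phi) /\ (forall v, free2 v phi -> v \in vs).

(** [Q] is a generalized quantifier, with its free variables displayed as two
    non-empty tuples of variables [Rs] and [Rs']. *)
Definition generalized_quantifier (Rs Rs' : seq rvar) (Q : formula) :=
  [/\ Rs != [::], Rs' != [::], uniq (Rs ++ Rs') & displayed (Rs ++ Rs') Q].

(** The union of the fields of the variables in [Rs]. *)
Definition field_of (Rs : seq rvar) : rterm 1 :=
  foldr (fun v t => RCup (RField (RVar v.1 v.2)) t) (REmpty 0) Rs.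

(** The substitution turning Q(Rs, Rs') into Q(Rs, U(Rs) /\ Rs'). *)
Definition bound_by_field (Rs Rs' : seq rvar) : rsubstitution :=
  fun m i => if (m, i) \in Rs'
             then RCap (RPow m (field_of Rs)) (RVar m i) else RVar m i.

(** The assignment also gives values to variables not free in [Q]; these do not
    affect satisfaction, and exist since all ranges are non-empty. *)
Definition henkin_domain_independent (T : theory) (Q : formula) :=
  forall (U : Type) (M N : henkin U),
    is_model M T -> is_model N T -> substructure M N ->
    forall e r, assignment_in M e r -> (sat M e r Q <-> sat N e r Q).

Definition henkin_conservative (T : theory) (Rs Rs' : seq rvar) (Q : formula) :=
  provable T (FIff Q (fsubst (bound_by_field Rs Rs') Q)).

Definition strong_existential_import (T : theory) (Rs : seq rvar)
    (Q : formula) :=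
  provable T (FImp Q (FNot (FREq (field_of Rs) (REmpty 0)))).

Definition bounded_first_order_definable (T : theory) (Rs Rs' : seq rvar)
    (Q : formula) :=
  exists Phi : formula,
    [/\ first_order Phi, displayed (Rs ++ Rs') Phi
      & provable T (FIff Q (relativize (field_of Rs) Phi))].

(* Main.v *)
(** By compactness it is enough that saturated models of the theory satisfying
    the same bounded first-order sentences agree on [Q].

    In such a model let [S] be the first-order structure with domain the union
    of the fields of [Rs], the order and the relations in [Rs], [Rs'] cut down to
    this domain.  Since [S] is saturated and its definable sets have least
    elements, [S] with its parametrically definable relations is again a model of
    the theory (Barwise and Schlipf): when every [x] has a definable witness,
    saturation bounds the number of defining formulas needed, and the
    well-order selects one formula and least parameters uniformly in [x].  By
    conservativity and domain independence, [Q] has the same truth value in the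
    big model and in this small one.  Finally, two saturated elementarily
    equivalent structures with their definable relations satisfy the same
    second-order sentences, by back and forth.

    Saturation and compactness both come from ultraproducts over [nat], which are
    countably saturated. *)

From HB Require Import structures.
Require Import Defs.
From mathcomp Require Import all_boot.
From mathcomp Require Import boolp classical_sets filter.

Set Implicit Arguments.
Unset Strict Implicit.
Unset Printing Implicit Defensive.

Local Open Scope classical_set_scope.

(** * Environments and satisfaction *)

(** Over the definable relations, second-order objects become syntax: a relation is a formula of
    [fo] with finitely many parameters. One assignment [p] carries all individuals and parameters,
    and [delta] records the formula behind each relation variable. Translations are uniform in the
    structure, so that the same names can be evaluated in two structures and compared.

    The obstacle is choice. That a formula and parameters define a witness is a Sigma^1_1 condition,
    hence not a formula of [fo] but an infinite disjunction of first-order certificates; saturation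
    is applied to these certificates.

    Since there are only countably many formulas, approximations are indexed by [nat]. If no finite
    set of bounded sentences decided [Q], there would be for every [N] two models with arguments
    that agree on the first [N] sentences and differ on [Q]; ultraproducts of both sequences along
    one ultrafilter would contradict the agreement of saturated models.

    Strong existential import settles the case of an empty field, on which there is no structure to
    consider. *)

Local Notation "s ++> e" := (foldr (@scons _) e s) (at level 60, right associativity).

Local Notation radd n X r := (@scons2 (fun m => set (m.+1.-tuple _)) n X r).

Section Environments.
Context {T : Type}.
Implicit Types (e : nat -> T) (s : seq T) (f : forall m, nat -> set (m.+1.-tuple T)).

Lemma scons2_0 (F : nat -> Type) n (t : F n) (f : forall m, nat -> F m) :
  scons2 t f n 0 = t.
Proof. by rewrite /scons2 dfwith_in. Qed.

Lemma scons2_S (F : nat -> Type) n (t : F n) (f : forall m, nat -> F m) i :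
  scons2 t f n i.+1 = f n i.
Proof. by rewrite /scons2 dfwith_in. Qed.

Lemma scons2_neq (F : nat -> Type) n (t : F n) (f : forall m, nat -> F m) m i :
  n != m -> scons2 t f m i = f m i.
Proof. by move=> nm; rewrite /scons2 dfwith_out. Qed.

Lemma scons2_shift (F : nat -> Type) n (t : F n) (f : forall m, nat -> F m) m i :
  scons2 t f m (shift2 n m i) = f m i.
Proof.
rewrite /shift2; case: eqVneq => [->|mn]; first by rewrite scons2_S.
by rewrite scons2_neq // eq_sym.
Qed.

Lemma rassignment_ext U (r r' : rassignment U) : (forall m i, r m i = r' m i) -> r = r'.
Proof.
by move=> h; apply: functional_extensionality_dep => m; apply: funext => i.
Qed.

Lemma radd_0 U n (X : set (n.+1.-tuple U)) (r : rassignment U) : radd n X r n 0 = X.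
Proof. exact: (scons2_0 (F := fun m => set (m.+1.-tuple U))). Qed.

Lemma radd_S U n (X : set (n.+1.-tuple U)) (r : rassignment U) i :
  radd n X r n i.+1 = r n i.
Proof. exact: (scons2_S (F := fun m => set (m.+1.-tuple U))). Qed.

Lemma radd_neq U n (X : set (n.+1.-tuple U)) (r : rassignment U) m i :
  n != m -> radd n X r m i = r m i.
Proof. exact: (scons2_neq (F := fun m => set (m.+1.-tuple U))). Qed.

Lemma radd_shift U n (X : set (n.+1.-tuple U)) (r : rassignment U) m i :
  radd n X r m (shift2 n m i) = r m i.
Proof. exact: (scons2_shift (F := fun m => set (m.+1.-tuple U))). Qed.

Lemma radd_eq U n (X : set (n.+1.-tuple U)) (r r' : rassignment U) :
  r' n 0 = X -> (forall i, r' n i.+1 = r n i) ->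
  (forall m i, n != m -> r' m i = r m i) -> r' = radd n X r.
Proof.
move=> h0 hS hN; apply: rassignment_ext => m i.
have [<-|nm] := eqVneq n m; last by rewrite radd_neq ?hN.
by case: i => [|i]; rewrite ?radd_0 ?radd_S ?h0 ?hS.
Qed.

Lemma env_lt d s e x : x < size s -> (s ++> e) x = nth d s x.
Proof. by elim: s x => [|a s IH] [|x] //= /IH. Qed.

Lemma env_ge s e x : (s ++> e) (size s + x) = e x.
Proof. by elim: s => [|a s IH]. Qed.

Lemma env_case s e x :
  (s ++> e) x = if x < size s then nth (e 0) s x else e (x - size s).
Proof.
case: ltnP => [xs|sx]; first exact: env_lt.
by rewrite -{1}(subnKC sx) env_ge.
Qed.

Lemma env_cat s1 s2 e : (s1 ++ s2) ++> e = s1 ++> s2 ++> e.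
Proof. exact: foldr_cat. Qed.

Lemma map_ivars k (s : k.-tuple T) e : map_tuple (s ++> e) (ivars k) = s.
Proof.
apply: eq_from_tnth => i.
by rewrite tnth_map tnth_mktuple (env_lt (tnth s i)) ?size_tuple // -tnth_nth.
Qed.

Lemma scons_in (D : set T) a e :
  D a -> (forall x, D (e x)) -> forall x, D (scons a e x).
Proof. by move=> Da De []. Qed.

Fixpoint alls (D : set T) s := if s is a :: s' then D a /\ alls D s' else True.

Lemma alls_cat D s1 s2 : alls D (s1 ++ s2) <-> alls D s1 /\ alls D s2.
Proof. by elim: s1 => [|a s1 IH] /=; tauto. Qed.

Lemma alls_rcons D s a : alls D (rcons s a) <-> alls D s /\ D a.
Proof. by rewrite -cats1 alls_cat /=; tauto. Qed.

Lemma alls_nth D s : alls D s <-> (forall d x, x < size s -> D (nth d s x)).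
Proof.
elim: s => [|a s IH] //=; split=> [[Da /IH h] d [|x]|h] //; first exact: h.
by split; [exact: (h a 0)|apply/IH => d x; exact: (h d x.+1)].
Qed.

Lemma alls_tnth D n (s : n.-tuple T) : alls D s <-> (forall i, D (tnth s i)).
Proof.
split=> [/alls_nth h i|h]; first by rewrite (tnth_nth (tnth s i)); apply: h; rewrite size_tuple.
apply/alls_nth => d x; rewrite size_tuple => xn.
by have := h (Ordinal xn); rewrite (tnth_nth d).
Qed.

Lemma alls_mkseq D (f : nat -> T) n : (forall x, D (f x)) -> alls D (mkseq f n).
Proof.
by move=> fD; apply/alls_nth => d x; rewrite size_mkseq => xn; rewrite nth_mkseq.
Qed.

Lemma env_in D s e :
  alls D s -> (forall x, D (e x)) -> forall x, D ((s ++> e) x).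
Proof.
by move=> /alls_nth sD eD x; rewrite env_case; case: ltnP => // /sD.
Qed.

End Environments.

Section Semantics.
Context {U : Type}.
Implicit Types (M : henkin U) (e : nat -> U) (r : rassignment U).

Lemma teval_coin n (t : rterm n) e e' r r' :
  (forall x, tfree1 x t -> e x = e' x) ->
  (forall v, tfree2 v t -> r v.1 v.2 = r' v.1 v.2) ->
  teval e r t = teval e' r' t.
Proof.
elim: n / t => //=.
- by move=> n i _ /(_ (n, i)); rewrite eqxx => ->.
- move=> n t IHt s IHs h1 h2.
  by rewrite IHt ?IHs // => x xt; rewrite ?h1 ?h2 ?xt ?orbT.
- move=> n t IHt s IHs h1 h2.
  by rewrite IHt ?IHs // => x xt; rewrite ?h1 ?h2 ?xt ?orbT.
- move=> n t IHt s IHs h1 h2.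
  by rewrite IHt ?IHs // => x xt; rewrite ?h1 ?h2 ?xt ?orbT.
- move=> m n t IHt s IHs h1 h2.
  by rewrite IHt ?IHs // => x xt; rewrite ?h1 ?h2 ?xt ?orbT.
- by move=> n t IHt h1 h2; rewrite IHt.
- by move=> n i t IHt h1 h2; rewrite IHt.
- by move=> n t IHt h1 h2; rewrite IHt.
- move=> m n t IHt xs h1 h2.
  rewrite IHt // => [|x xt]; last by rewrite h1 ?xt.
  suff -> : map_tuple e xs = map_tuple e' xs by [].
  apply: eq_from_tnth => i; rewrite !tnth_map h1 //.
  by rewrite mem_tnth orbT.
Qed.

Lemma sat_coin M phi e e' r r' :
  (forall x, free1 x phi -> e x = e' x) ->
  (forall v, free2 v phi -> r v.1 v.2 = r' v.1 v.2) ->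
  sat M e r phi <-> sat M e' r' phi.
Proof.
elim: phi e e' r r' => /=.
- by move=> x y e e' r r' h _; rewrite !h ?eqxx ?orbT.
- by move=> x y e e' r r' h _; rewrite !h ?eqxx ?orbT.
- move=> n t xs e e' r r' h1 h2.
  rewrite (@teval_coin _ t e e' r r') // => [|x xt]; last by rewrite h1 ?xt.
  suff -> : map_tuple e xs = map_tuple e' xs by [].
  apply: eq_from_tnth => i; rewrite !tnth_map h1 //.
  by rewrite mem_tnth orbT.
- move=> n t s e e' r r' h1 h2.
  by rewrite (@teval_coin _ t e e' r r') ?(@teval_coin _ s e e' r r') //
    => x xt; rewrite ?h1 ?h2 ?xt ?orbT.
- move=> n t s e e' r r' h1 h2.
  by rewrite (@teval_coin _ t e e' r r') ?(@teval_coin _ s e e' r r') //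
    => x xt; rewrite ?h1 ?h2 ?xt ?orbT.
- by move=> p IH e e' r r' h1 h2; rewrite (IH e e' r r').
- move=> p IHp q IHq e e' r r' h1 h2.
  by rewrite (IHp e e' r r') ?(IHq e e' r r') // => x xp;
    rewrite ?h1 ?h2 ?xp ?orbT.
- move=> p IH e e' r r' h1 h2; split=> -[a Da h]; exists a => //; move: h;
    rewrite (IH _ (scons a e') _ r') // => -[|x] //= xp; rewrite h1 //.
- move=> n p IH e e' r r' h1 h2.
  have E X v : free2 v p -> radd n X r v.1 v.2
     = radd n X r' v.1 v.2.
    case: v => m i /= vp; have [nm|nm] := eqVneq n m.
      case: m / nm vp => vp; case: i vp => [|i] vp; rewrite ?scons2_0 ?scons2_S //.
      by rewrite (h2 (n, i)) // /shift2 /= eqxx.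
    by rewrite !scons2_neq // (h2 (m, i)) // /shift2 /= eq_sym (negPf nm).
  by split=> -[X HX h]; exists X => //; move: h;
     rewrite (IH _ e' _ (radd n X r')) //;
     move=> v /(E X) ->.
Qed.

Lemma teval_ren1 n (t : rterm n) rho e r :
  teval e r (tren1 rho t) = teval (e \o rho) r t.
Proof.
elim: n / t => //=.
- by move=> n t -> s ->.
- by move=> n t -> s ->.
- by move=> n t -> s ->.
- by move=> m n t -> s ->.
- by move=> n t ->.
- by move=> n i t ->.
- by move=> n t ->.
- move=> m n t -> xs; suff -> : map_tuple e (map_tuple rho xs) = map_tuple (e \o rho) xs by [].
  by apply: eq_from_tnth => i; rewrite !tnth_map.
Qed.

Lemma teval_subst n (t : rterm n) (sigma : rsubstitution) e r :
  teval e r (tsubst sigma t) = teval e (fun m i => teval e r (sigma m i)) t.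
Proof.
elim: n / t => //=.
- by move=> n t -> s ->.
- by move=> n t -> s ->.
- by move=> n t -> s ->.
- by move=> m n t -> s ->.
- by move=> n t ->.
- by move=> n i t ->.
- by move=> n t ->.
- by move=> m n t -> xs.
Qed.

Lemma sat_subst M phi (sigma : rsubstitution) e r :
  sat M e r (fsubst sigma phi)
  <-> sat M e (fun m i => teval e r (sigma m i)) phi.
Proof.
elim: phi sigma e r => //=.
- by move=> n t xs sigma e r; rewrite teval_subst.
- by move=> n t s sigma e r; rewrite !teval_subst.
- by move=> n t s sigma e r; rewrite !teval_subst.
- by move=> p IH sigma e r; rewrite IH.
- by move=> p IHp q IHq sigma e r; rewrite IHp IHq.
- move=> p IH sigma e r.
  suff E a : sat M (scons a e) r (fsubst (fun m i => tren1 succn (sigma m i)) p)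
     <-> sat M (scons a e) (fun m i => teval e r (sigma m i)) p.
    by split=> -[a Da]; exists a => //; apply/E.
  rewrite IH.
  suff -> : (fun m i => teval (scons a e) r (tren1 succn (sigma m i))) =
     (fun m i => teval e r (sigma m i)) :> rassignment U by [].
  by apply: rassignment_ext => m i; rewrite teval_ren1.
- move=> n p IH sigma e r.
  suff E (X : set (n.+1.-tuple U)) : sat M e (radd n X r) (fsubst
      (@scons2 (fun m => rterm m.+1) n (RVar n 0) (fun m i => tsubst (lift2 n) (sigma m i))) p)
     <-> sat M e (radd n X (fun m i => teval e r (sigma m i))) p.
    by split=> -[X HX h]; exists X => //; apply/E.
  rewrite IH.
  set r1 := fun m i => _; set r2 := scons2 _ _.
  suff -> : r1 = r2 :> rassignment U by [].
  apply: rassignment_ext => m i; rewrite /r1 /r2.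
  have lift0 (m' : nat) (t : rterm m') :
      teval e (radd n X r) (tsubst (lift2 n) t) = teval e r t.
    rewrite teval_subst /=; set r0 := fun m i => _.
    suff -> : r0 = r :> rassignment U by [].
    by apply: rassignment_ext => k j; exact: radd_shift.
  have [nm|nm] := eqVneq n m.
    case: m / nm; case: i => [|i].
      rewrite (@scons2_0 (fun m => rterm m.+1)) radd_0 /=.
      by rewrite radd_0.
    rewrite (@scons2_S (fun m => rterm m.+1)) radd_S.
    exact: lift0.
  by rewrite (@scons2_neq (fun m => rterm m.+1)) // radd_neq.
Qed.

Lemma sat_lift2 M n (X : set (n.+1.-tuple U)) e r phi :
  sat M e (radd n X r) (fsubst (lift2 n) phi)
  <-> sat M e r phi.
Proof.
rewrite sat_subst /=; set r1 := fun m i => _.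
suff -> : r1 = r by [].
by apply: rassignment_ext => m i; exact: radd_shift.
Qed.

Lemma sat_imp M e r phi psi :
  sat M e r (FImp phi psi) <-> (sat M e r phi -> sat M e r psi).
Proof. by rewrite /=; split=> [/not_andP[//|/contrapT]|h [/h]]. Qed.

Lemma sat_iff M e r phi psi :
  sat M e r (FIff phi psi) <-> (sat M e r phi <-> sat M e r psi).
Proof. by rewrite [sat _ _ _ _]/=; split=> [[/sat_imp ? /sat_imp ?]|[? ?]]; split=> //; exact/sat_imp. Qed.

Lemma sat_all1 M e r phi :
  sat M e r (FAll1 phi) <-> forall a, hdom M a -> sat M (scons a e) r phi.
Proof.
split=> /= [h a Da|h [a Da]]; last by apply; exact: h.
by apply: contrapT => na; apply: h; exists a.
Qed.

Lemma sat_all2 M e r n phi :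
  sat M e r (FAll2 n phi) <->
  forall X, hrel M n X -> sat M e (radd n X r) phi.
Proof.
split=> /= [h X HX|h [X HX]]; last by apply; exact: h.
by apply: contrapT => na; apply: h; exists X.
Qed.

Lemma sat_alls M k e r phi :
  sat M e r (FAlls k phi) <->
  forall s, size s = k -> alls (hdom M) s -> sat M (s ++> e) r phi.
Proof.
elim: k e => [|k IH] e; first by split=> [h [|//] _|/(_ [::])]; [|apply].
rewrite [FAlls _ _]/= sat_all1; split=> [h s|h a Da].
  (* The outermost quantifier binds the variable of highest index, so the list is taken apart from
     its right end. *)
  case/lastP: s => // s a; rewrite size_rcons => -[sk] /alls_rcons[sD aD].
  by rewrite -cats1 env_cat; apply: (IH _).1 => //; apply: h.
apply/IH => s sk sD; rewrite (_ : s ++> scons a e = rcons s a ++> e).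
  by apply: h; [rewrite size_rcons sk|apply/alls_rcons].
by rewrite -cats1 env_cat.
Qed.

End Semantics.

(** * First-order formulas and uniform definability *)

(** Relation terms and relation quantifiers are absent. What remains is a countable type, so that
    sets of formulas can be enumerated for saturation and compactness. *)
Inductive fo : Type :=
| FoEq (x y : nat)
| FoLe (x y : nat)
| FoRel (n i : nat) (xs : n.+1.-tuple nat)
| FoNot (phi : fo)
| FoAnd (phi psi : fo)
| FoEx (phi : fo).

Fixpoint fo_encode phi : GenTree.tree nat :=
  match phi with
  | FoEq x y => GenTree.Node 0 [:: GenTree.Leaf x; GenTree.Leaf y]
  | FoLe x y => GenTree.Node 1 [:: GenTree.Leaf x; GenTree.Leaf y]
  | FoRel n i xs => GenTree.Node 2
      [:: GenTree.Leaf n, GenTree.Leaf i & [seq GenTree.Leaf x | x <- xs]]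
  | FoNot p => GenTree.Node 3 [:: fo_encode p]
  | FoAnd p q => GenTree.Node 4 [:: fo_encode p; fo_encode q]
  | FoEx p => GenTree.Node 5 [:: fo_encode p]
  end.

Fixpoint fo_decode (t : GenTree.tree nat) : option fo :=
  match t with
  | GenTree.Node 0 [:: GenTree.Leaf x; GenTree.Leaf y] => Some (FoEq x y)
  | GenTree.Node 1 [:: GenTree.Leaf x; GenTree.Leaf y] => Some (FoLe x y)
  | GenTree.Node 2 [:: GenTree.Leaf n, GenTree.Leaf i & s] =>
      omap (@FoRel n i)
        (insub (pmap (fun t => if t is GenTree.Leaf x then Some x else None) s))
  | GenTree.Node 3 [:: p] => omap FoNot (fo_decode p)
  | GenTree.Node 4 [:: p; q] =>
      if (fo_decode p, fo_decode q) is (Some p', Some q')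
      then Some (FoAnd p' q') else None
  | GenTree.Node 5 [:: p] => omap FoEx (fo_decode p)
  | _ => None
  end.

Lemma fo_encodeK : pcancel fo_encode fo_decode.
Proof.
elim=> //= [n i xs|p ->|p -> q ->|p ->] //.
by rewrite (map_pK (g := @GenTree.Leaf nat)) // valK.
Qed.

HB.instance Definition _ := Countable.copy fo (pcan_type fo_encodeK).

Definition up (rho : nat -> nat) : nat -> nat := scons 0 (succn \o rho).

Fixpoint fren (rho : nat -> nat) phi : fo :=
  match phi with
  | FoEq x y => FoEq (rho x) (rho y)
  | FoLe x y => FoLe (rho x) (rho y)
  | FoRel n i xs => FoRel i (map_tuple rho xs)
  | FoNot p => FoNot (fren rho p)
  | FoAnd p q => FoAnd (fren rho p) (fren rho q)
  | FoEx p => FoEx (fren (up rho) p)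
  end.

(** A strict bound on the free variables: [fbound phi = 0] serves as the test for sentences, and in
    general it bounds the number of parameters on which a definable set depends. *)
Fixpoint fbound phi : nat :=
  match phi with
  | FoEq x y | FoLe x y => maxn x.+1 y.+1
  | FoRel n i xs => \max_(k < n.+1) (tnth xs k).+1
  | FoNot p => fbound p
  | FoAnd p q => maxn (fbound p) (fbound q)
  | FoEx p => (fbound p).-1
  end.

(** The relations [fR] may reach beyond the domain [fD]; only definable sets are cut down to it, in
    [fset]. *)
Record fstruct := FStruct {
  fU : Type;
  fD : set fU;
  fle : fU -> fU -> Prop;
  fR : rassignment fU;
  fD_nonempty : fD !=set0
}.
Arguments fD : clear implicits.

Fixpoint fsat (S : fstruct) phi (p : nat -> fU S) : Prop :=
  match phi with
  | FoEq x y => p x = p y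
  | FoLe x y => fle (p x) (p y)
  | FoRel n i xs => @fR S n i (map_tuple p xs)
  | FoNot q => ~ fsat q p
  | FoAnd q1 q2 => fsat q1 p /\ fsat q2 p
  | FoEx q => exists2 a, fD S a & fsat q (scons a p)
  end.

Lemma scons_up T (a : T) p rho : scons a p \o up rho = scons a (p \o rho).
Proof. by apply: funext => -[|x]. Qed.

Lemma fsat_ren S phi rho (p : nat -> fU S) :
  fsat (fren rho phi) p <-> fsat phi (p \o rho).
Proof.
elim: phi rho p => //=.
- move=> n i xs rho p.
  suff -> : map_tuple p (map_tuple rho xs) = map_tuple (p \o rho) xs by [].
  by apply: eq_from_tnth => k; rewrite !tnth_map.
- by move=> q IH rho p; rewrite IH.
- by move=> q1 IH1 q2 IH2 rho p; rewrite IH1 IH2.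
- move=> q IH rho p.
  by split=> -[a Da]; exists a => //; move: q0; rewrite IH scons_up.
Qed.

Lemma fsat_bound S phi (p p' : nat -> fU S) :
  (forall x, x < fbound phi -> p x = p' x) -> fsat phi p <-> fsat phi p'.
Proof.
elim: phi p p' => /=.
- by move=> x y p p' h; rewrite !h // leq_max leqnn ?orbT.
- by move=> x y p p' h; rewrite !h // leq_max leqnn ?orbT.
- move=> n i xs p p' h.
  suff -> : map_tuple p xs = map_tuple p' xs by [].
  apply: eq_from_tnth => k; rewrite !tnth_map h //.
  exact: (@leq_bigmax _ (fun k => (tnth xs k).+1)).
- by move=> q IH p p' h; rewrite (IH p p').
- by move=> q1 IH1 q2 IH2 p p' h;
    rewrite (IH1 p p') ?(IH2 p p') // => x xb; rewrite h // leq_max xb ?orbT.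
- move=> q IH p p' h.
  have E a : fsat q (scons a p) <-> fsat q (scons a p').
    by apply: IH => -[|x] //= xb; apply: h; case: (fbound q) xb.
  by split=> -[a Da] /E; exists a.
Qed.

(** Identifying all variables leaves a formula that a single quantifier closes. This reduces
    statements about constant assignments to sentences. *)
Lemma fbound_ren0 phi : fbound (fren (fun=> 0) phi) <= 1.
Proof.
suff H k rho : (forall x, rho x < k.+1) -> fbound (fren rho phi) <= k.+1 by exact: H.
elim: phi k rho => /= [x y|x y|n i xs|q IH|q1 IH1 q2 IH2|q IH] k rho h.
- by rewrite geq_max !h.
- by rewrite geq_max !h.
- by apply/bigmax_leqP => j _; rewrite tnth_map h.
- exact: IH.
- by rewrite geq_max IH1 ?IH2.
- have : fbound (fren (up rho) q) <= k.+2 by apply: IH => -[|x] //=; rewrite ltnS.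
  by case: fbound.
Qed.

Lemma fo_conjunction (l : seq fo) : exists f, forall S (p : nat -> fU S),
  fsat f p <-> forall psi, psi \in l -> fsat psi p.
Proof.
elim: l => [|g l [f hf]]; first by exists (FoEq 0 0) => S p; split.
exists (FoAnd g f) => S p /=; rewrite hf; split.
  by move=> [hg hl] psi; rewrite inE => /predU1P[->|/hl].
by move=> H; split=> [|psi pl]; apply: H; rewrite inE ?eqxx // pl orbT.
Qed.

Section Definability.
Implicit Types (P : forall S : fstruct, (nat -> fU S) -> Prop).

(** One formula must serve all structures at once. The closure properties below produce such
    formulas from their meaning, without writing them out. *)
Definition fodef P := exists phi, forall S (p : nat -> fU S),
  (forall x, fD S (p x)) -> fsat phi p <-> P S p.

Lemma fodef_ext P P' :
  (forall S (p : nat -> fU S), (forall x, fD S (p x)) -> P S p <-> P' S p) -> fodef P -> fodef P'.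
Proof. by move=> h [phi H]; exists phi => S p Dp; rewrite H // h. Qed.

Lemma fodef_fsat phi : fodef (fun S p => fsat phi p).
Proof. by exists phi. Qed.

Lemma fodef_not P : fodef P -> fodef (fun S p => ~ P S p).
Proof. by move=> [phi h]; exists (FoNot phi) => S p Dp /=; rewrite h. Qed.

Lemma fodef_and P P' : fodef P -> fodef P' -> fodef (fun S p => P S p /\ P' S p).
Proof.
by move=> [f h] [f' h']; exists (FoAnd f f') => S p Dp /=; rewrite h // h'.
Qed.

Lemma fodef_or P P' : fodef P -> fodef P' -> fodef (fun S p => P S p \/ P' S p).
Proof.
move=> /fodef_not dP /fodef_not dP'; move: (fodef_not (fodef_and dP dP')).
apply: fodef_ext => S p _; split=> [/not_andP[]/contrapT|]; tauto.
Qed.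

Lemma fodef_imp P P' : fodef P -> fodef P' -> fodef (fun S p => P S p -> P' S p).
Proof.
move=> dP /fodef_not dP'; move: (fodef_not (fodef_and dP dP')).
by apply: fodef_ext => S p _; split=> [/not_andP[//|/contrapT]|]; tauto.
Qed.

Lemma fodef_iff P P' : fodef P -> fodef P' -> fodef (fun S p => P S p <-> P' S p).
Proof.
move=> dP dP'; exact: fodef_and (fodef_imp dP dP') (fodef_imp dP' dP).
Qed.

Lemma fodef_ex P : fodef P -> fodef (fun S p => exists2 a, fD S a & P S (scons a p)).
Proof.
move=> [f h]; exists (FoEx f) => S p Dp /=.
by split=> -[a Da] H; exists a => //; apply/h => //; exact: scons_in.
Qed.

Lemma fodef_all P : fodef P -> fodef (fun S p => forall a, fD S a -> P S (scons a p)).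
Proof.
move=> /fodef_not/fodef_ex/fodef_not; apply: fodef_ext => S p _.
split=> [h a Da|h [a Da]]; last by apply; exact: h.
by apply: contrapT => na; apply: h; exists a.
Qed.

Lemma fsat_exs K phi S (p : nat -> fU S) :
  fsat (iter K FoEx phi) p
  <-> exists q, [/\ size q = K, alls (fD S) q & fsat phi (q ++> p)].
Proof.
elim: K phi => [|K IH] phi; first by split=> [h|[[|a q] []] //]; exists [::].
rewrite iterSr IH /=; split=> [[q [<- Dq [a Da h]]]|]; first by exists (a :: q).
by move=> [[|a q] []] // [<-] [Da Dq] h; exists q; split=> //; exists a.
Qed.

Lemma fodef_exs K P : fodef P ->
  fodef (fun S p => exists q, [/\ size q = K, alls (fD S) q & P S (q ++> p)]).
Proof.
move=> [f h]; exists (iter K FoEx f) => S p Dp; rewrite fsat_exs.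
by split=> -[q [sq Dq H]]; exists q; split=> //; apply/h => //; exact: env_in.
Qed.

Lemma fodef_alls K P : fodef P ->
  fodef (fun S p => forall q, size q = K -> alls (fD S) q -> P S (q ++> p)).
Proof.
move=> /fodef_not/(fodef_exs K)/fodef_not; apply: fodef_ext => S p _.
split=> [h q sq Dq|h [q [sq Dq]]]; last by apply; exact: h.
by apply: contrapT => na; apply: h; exists q.
Qed.

Lemma fodef_ren rho P : fodef P -> fodef (fun S p => P S (p \o rho)).
Proof.
by move=> [f h]; exists (fren rho f) => S p Dp; rewrite fsat_ren h // => x /=.
Qed.

Lemma fodef_cst (b : Prop) : fodef (fun S p => b).
Proof.
have [hb|nb] := pselect b.
  by exists (FoEq 0 0) => S p _ /=.
by exists (FoNot (FoEq 0 0)) => S p _ /=; split.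
Qed.

Lemma fodef_forall_fin (I : finType) (P : I -> forall S, (nat -> fU S) -> Prop) :
  (forall i, fodef (P i)) -> fodef (fun S p => forall i, P i S p).
Proof.
move=> dP.
suff: fodef (fun S p => forall i, i \in enum I -> P i S p).
  apply: fodef_ext => S p _; split=> h i; last by move=> _; exact: h.
  by apply: h; rewrite mem_enum.
elim: (enum I) => [|j s IH].
  by apply: fodef_ext (fodef_cst True) => S p _; split.
apply: fodef_ext (fodef_and (dP j) IH) => S p _; split.
  by move=> [hj hs] i; rewrite inE => /predU1P[->|/hs].
by move=> h; split=> [|i si]; apply: h; rewrite inE ?eqxx // si orbT.
Qed.

Lemma fodef_exists_fin (I : finType) (P : I -> forall S, (nat -> fU S) -> Prop) :
  (forall i, fodef (P i)) -> fodef (fun S p => exists i, P i S p).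
Proof.
move=> dP; apply: fodef_ext (fodef_not (fodef_forall_fin (fun i => fodef_not (dP i)))).
move=> S p _; split=> [|[i Pi]]; last by move=> /(_ i).
by move=> /existsNP[i /contrapT]; exists i.
Qed.

End Definability.

(** * The Henkin model of parametrically definable relations *)

Section DefinableSets.
Variable S : fstruct.

Definition fset n phi (p : nat -> fU S) : set (n.-tuple (fU S)) :=
  [set u | alls (fD S) u /\ fsat phi (u ++> p)].

Program Definition defmodel : henkin (fU S) :=
  @Henkin _ (fD S)
    (fun n => [set X | exists phi p, (forall x, fD S (p x)) /\ X = @fset n.+1 phi p])
    (fun x y => [/\ fD S x, fD S y & fle x y]) _ _ _ _.
Next Obligation. exact: fD_nonempty. Qed.
Next Obligation.
move=> n; have [a Da] := fD_nonempty S.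
by exists (@fset n.+1 (FoEq 0 0) (fun=> a)); exists (FoEq 0 0), (fun=> a).
Qed.
Next Obligation. by move=> n X [phi [p [_ ->]]] t [/alls_tnth]. Qed.
Next Obligation. by move=> x y []. Qed.

(** All relations of the assignment draw their parameters from the same [p], so [delta] is a purely
    syntactic name that makes sense in every structure. *)
Definition drel (delta : nat -> nat -> fo) (p : nat -> fU S) : rassignment (fU S) :=
  fun n i => @fset n.+1 (delta n i) p.

End DefinableSets.

(** * Translation of formulas about definable relations *)

(** The lift of [rho] under [k] binders. *)
Definition upn k (rho : nat -> nat) x := if x < k then x else k + rho (x - k).

Lemma env_upn T (s : seq T) p k rho :
  size s = k -> (s ++> p) \o upn k rho = s ++> (p \o rho).
Proof.
move=> <-; apply: funext => x; rewrite /= /upn [RHS]env_case.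
case: ltnP => [xs|sx]; last by rewrite env_ge.
by rewrite (env_lt (p 0)) //; exact: set_nth_default.
Qed.

Lemma env_addn T (s : seq T) p k : size s = k -> (s ++> p) \o addn k = p.
Proof. by move=> <-; apply: funext => x /=; rewrite env_ge. Qed.

(** This renaming feeds the arguments [xs] to the first [n] variables of a formula, reaching past
    the tuple [s] already in scope. Atoms and sections are translated with it. *)
Lemma env_args T (p : nat -> T) rho n (xs : n.-tuple nat) (s : seq T) :
  (s ++> p) \o (fun x => if x < n then size s + rho (nth 0 xs x) else x - n)
  = map_tuple (p \o rho) xs ++> s ++> p.
Proof.
apply: funext => x; rewrite /= [RHS]env_case size_map size_tuple.
by case: ltnP => // xn; rewrite env_ge (nth_map 0) ?size_tuple.
Qed.

Lemma tuple_split T m n (u : (m + n).-tuple T) :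
  exists a : m.-tuple T, exists b : n.-tuple T, u = cat_tuple a b.
Proof.
have sa : size (take m u) == m by rewrite size_takel // size_tuple leq_addr.
have sb : size (drop m u) == n by rewrite size_drop size_tuple addKn.
by exists (Tuple sa), (Tuple sb); apply: val_inj; rewrite /= cat_take_drop.
Qed.

Lemma cat_tuple_inj T m n (a a' : m.-tuple T) (b b' : n.-tuple T) :
  cat_tuple a b = cat_tuple a' b' -> a = a' /\ b = b'.
Proof.
move=> /(congr1 val) /= h; split; apply: val_inj => /=.
  by move: (congr1 (take m) h); rewrite !take_size_cat ?size_tuple.
by move: (congr1 (drop m) h); rewrite !drop_size_cat ?size_tuple.
Qed.

Lemma teval_dom U (D : set U) e (r : rassignment U) n (t : rterm n) u :
  (forall n i (v : n.+1.-tuple U), r n i v -> alls D v) ->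
  teval e r t u -> alls D u.
Proof.
move=> rD; elim: n / t u => //=.
- by move=> n t IHt s IHs u [/IHt].
- by move=> n t IHt s IHs u [/IHt|/IHs].
- by move=> n t IHt s IHs u [/IHt].
- by move=> m n t IHt s IHs u [a [b [/IHt ha /IHs hb ->]]]; rewrite alls_cat.
- by move=> n t IHt u h; apply/alls_tnth => i; have /IHt[] := h i.
- move=> n i t IHt u [a /IHt/alls_tnth ha ua].
  by apply/alls_tnth => j; rewrite ord1 -[tnth u _]/(thead u) ua.
- move=> n t IHt u [i [a /IHt/alls_tnth ha ua]].
  by apply/alls_tnth => j; rewrite ord1 -[tnth u _]/(thead u) ua.
- by move=> m n t IHt xs u /IHt; rewrite alls_cat => -[].
Qed.

Lemma teval_drel_dom S delta (p e : nat -> fU S) n (t : rterm n) u :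
  teval e (drel delta p) t u -> alls (fD S) u.
Proof. by apply: teval_dom => m i v []. Qed.

Lemma fset_ren S n phi rho (p : nat -> fU S) :
  fset (n := n) (fren (upn n rho) phi) p = fset phi (p \o rho).
Proof.
by apply/seteqP; split=> u [uD h]; split=> //; move: h;
  rewrite fsat_ren env_upn ?size_tuple.
Qed.

(** Only the parameters are renamed, not the argument places: when a binder extends [p], the old
    definitions must skip the new entries. *)
Definition dren rho (delta : nat -> nat -> fo) n i := fren (upn n.+1 rho) (delta n i).

Lemma drel_dren S delta rho (p : nat -> fU S) :
  drel (dren rho delta) p = drel delta (p \o rho).
Proof. by apply: rassignment_ext => n i; exact: fset_ren. Qed.

(** Every operation of the language on relations is first-order definable. The renaming [rho] keeps
    the individual variables of [t] apart from the parameters of [delta], since both are stored in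
    [p]. *)
Lemma term_translation n (t : rterm n) rho delta :
  exists psi, forall S (p : nat -> fU S) (u : n.-tuple (fU S)),
    (forall x, fD S (p x)) -> alls (fD S) u ->
    fsat psi (u ++> p) <-> teval (p \o rho) (drel delta p) t u.
Proof.
elim: n / t => [n i|n|n t [f hf] s [g hg]|n t [f hf] s [g hg]|n t [f hf] s [g hg]
  |m n t [f hf] s [g hg]|n t [f hf]|n i t [f hf]|n t [f hf]|m n t [f hf] xs].
- by exists (delta n i) => S p u Dp Du; split=> [|[]].
- have [f hf] := fodef_cst False; exists f => S p u Dp Du /=.
  by rewrite hf //; exact: env_in.
- have [h H] := fodef_and (fodef_fsat f) (fodef_fsat g); exists h => S p u Dp Du.
  by rewrite H; [rewrite hf // hg|exact: env_in].
- have [h H] := fodef_or (fodef_fsat f) (fodef_fsat g); exists h => S p u Dp Du.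
  by rewrite H; [rewrite hf // hg|exact: env_in].
- have [h H] := fodef_and (fodef_fsat f) (fodef_not (fodef_fsat g)); exists h => S p u Dp Du.
  by rewrite H; [rewrite hf // hg|exact: env_in].
- have [h H] := fodef_and (fodef_ren (upn m (addn n)) (fodef_fsat f)) (fodef_ren (addn m) (fodef_fsat g)).
  exists h => S p u Dp; have [a [b ->]] := tuple_split u.
  rewrite [tval _]/= alls_cat => -[Da Db].
  rewrite H; last by apply: env_in; rewrite ?alls_cat.
  rewrite env_cat env_upn ?size_tuple // env_addn ?size_tuple // env_addn ?size_tuple //.
  rewrite hf // hg //=; split=> [[ta sb]|[a' [b' [ta sb]]]]; first by exists a, b.
  by move=> /cat_tuple_inj[-> ->].
- have [h H] := fodef_forall_fin (fun i : 'I_n.+1 =>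
    fodef_ren (scons (i : nat) (addn n.+1)) (fodef_fsat f)).
  exists h => S p u Dp Du; rewrite H; last exact: env_in.
  suff E (i : 'I_n.+1) : fsat f ((u ++> p) \o scons (i : nat) (addn n.+1)) <->
     teval (p \o rho) (drel delta p) t [tuple tnth u i].
    by split=> hi i; apply/E; exact: hi.
  rewrite -hf //=; last by split=> //; move/alls_tnth: Du.
  rewrite (_ : _ \o _ = scons (tnth u i) p) //.
  apply: funext => -[|x] /=; last by have := env_ge u p x; rewrite size_tuple.
  by rewrite (env_lt (tnth u i)) ?size_tuple // -tnth_nth.
(* Below the block of [n] quantifiers, variable [n] is the argument of the projection; [upn n succn]
   makes [f] skip it on the way to the parameters. *)
- have [h H] := fodef_exs n (fodef_and (fodef_ren (upn n succn) (fodef_fsat f))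
    (fodef_fsat (FoEq n i))).
  exists h => S p u Dp Du; rewrite H; last exact: env_in.
  case/tupleP: u Du => u0 u; rewrite (tuple0 u) => -[Du0 _] {u}.
  rewrite (_ : (_ ++> p) = scons u0 p) //.
  have E (a : n.-tuple (fU S)) : tnth a i = (a ++> scons u0 p) i.
    by rewrite (env_lt (tnth a i)) ?size_tuple // -tnth_nth.
  have E' (a : n.-tuple (fU S)) : u0 = (a ++> scons u0 p) n.
    by have := env_ge a (scons u0 p) 0; rewrite size_tuple addn0 => ->.
  split=> [[q [/eqP sq Dq]]|[a ta /= ua]].
    rewrite -[q]/(tval (Tuple sq)) in Dq *; move: (Tuple sq) Dq => {sq} a Da.
    rewrite env_upn ?size_tuple // => -[/hf ta /=].
    by rewrite -E -E' => ua; exists a => //; exact: ta.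
  exists a; rewrite size_tuple env_upn ?size_tuple //; split=> //.
    exact: teval_drel_dom ta.
  split; last by rewrite /= -E -E'.
  by apply/hf => //; exact: teval_drel_dom ta.
- have [h H] := fodef_exists_fin (fun i : 'I_n => fodef_exs n (fodef_and (fodef_ren (upn n succn) (fodef_fsat f))
    (fodef_fsat (FoEq n i)))).
  exists h => S p u Dp Du; rewrite H; last exact: env_in.
  case/tupleP: u Du => u0 u; rewrite (tuple0 u) => -[Du0 _] {u}.
  rewrite (_ : (_ ++> p) = scons u0 p) //.
  have E (a : n.-tuple (fU S)) i : tnth a i = (a ++> scons u0 p) i.
    by rewrite (env_lt (tnth a i)) ?size_tuple // -tnth_nth.
  have E' (a : n.-tuple (fU S)) : u0 = (a ++> scons u0 p) n.
    by have := env_ge a (scons u0 p) 0; rewrite size_tuple addn0 => ->.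
  split=> [[i [q [/eqP sq Dq h1]]]|[i [a ta /= ua]]]; exists i; first move: h1.
    rewrite -[q]/(tval (Tuple sq)) in Dq *; move: (Tuple sq) Dq => {sq} a Da.
    rewrite env_upn ?size_tuple // => -[/hf ta /=].
    by rewrite -E -E' => ua; exists a => //; exact: ta.
  exists a; rewrite size_tuple env_upn ?size_tuple //; split=> //.
    exact: teval_drel_dom ta.
  split; last by rewrite /= -E -E'.
  by apply/hf => //; exact: teval_drel_dom ta.
- have [h H] := fodef_ren (fun x => if x < m.+1 then n.+1 + rho (nth 0 xs x) else x - m.+1)
    (fodef_fsat f).
  exists h => S p u Dp Du; rewrite H; last exact: env_in.
  rewrite (_ : _ \o _ = cat_tuple (map_tuple (p \o rho) xs) u ++> p).
    rewrite hf //= alls_cat; split=> //; apply/alls_nth => d x.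
    by rewrite size_map => xs_x; rewrite (nth_map 0) //; exact: Dp.
  by rewrite (env_cat (map_tuple _ _)) -env_args size_tuple.
Qed.

Lemma fo_translation phi rho delta : first_order phi ->
  fodef (fun S p => sat (defmodel S) (p \o rho) (drel delta p) phi).
Proof.
elim: phi rho delta => //=.
- by move=> x y rho delta _; exact: (fodef_fsat (FoEq (rho x) (rho y))).
- move=> x y rho delta _; exists (FoLe (rho x) (rho y)) => S p Dp /=.
  by split=> [|[]].
- move=> n t xs rho delta _; have [f hf] := term_translation t rho delta.
  apply: fodef_ext (fodef_ren (fun x => if x < n then rho (nth 0 xs x) else x - n) (fodef_fsat f)).
  move=> S p Dp; have -> := env_args p rho xs [::]; apply: hf => //=.
  by apply/alls_nth => d x; rewrite size_map => xs_x; rewrite (nth_map 0) //; exact: Dp.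
- move=> n t s rho delta _.
  have [f hf] := term_translation t rho delta.
  have [g hg] := term_translation s rho delta.
  apply: fodef_ext (fodef_alls n (fodef_iff (fodef_fsat f) (fodef_fsat g))).
  move=> S p Dp; split=> [h|E q /eqP sq Dq].
    apply/seteqP; split=> u tu; have Du : alls (fD S) u by exact: teval_drel_dom tu.
      by apply/hg => //; apply/h; rewrite ?size_tuple //; exact/hf.
    by apply/hf => //; apply/h; rewrite ?size_tuple //; exact/hg.
  by rewrite -[q]/(tval (Tuple sq)) hf // hg // E.
- move=> n t s rho delta _.
  have [f hf] := term_translation t rho delta.
  have [g hg] := term_translation s rho delta.
  apply: fodef_ext (fodef_alls n (fodef_imp (fodef_fsat f) (fodef_fsat g))).
  move=> S p Dp; split=> [h u tu|E q /eqP sq Dq].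
    have Du : alls (fD S) u by exact: teval_drel_dom tu.
    by apply/hg => //; apply/h; rewrite ?size_tuple //; exact/hf.
  by rewrite -[q]/(tval (Tuple sq)) hf // hg //; exact: E.
- by move=> p IH rho delta h; apply: fodef_not; exact: IH.
- by move=> p IHp q IHq rho delta /andP[/IHp hp /IHq hq]; exact: fodef_and.
- move=> p IH rho delta h.
  apply: fodef_ext (fodef_ex (IH (up rho) (dren succn delta) h)) => S q Dq.
  split=> -[a Da ha]; exists a => //; move: ha; rewrite scons_up drel_dren //.
Qed.

(** * Definable relations over a saturated well-ordered structure *)

(** Countable saturation: types in finitely many variables over countably many parameters, which are
    collected in one assignment [p]. *)
Definition saturated S := forall K (phi : nat -> fo) (p : nat -> fU S),
  (forall x, fD S (p x)) ->
  (forall N, exists q, [/\ size q = K, alls (fD S) q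
     & forall n, n < N -> fsat (phi n) (q ++> p)]) ->
  exists q, [/\ size q = K, alls (fD S) q & forall n, fsat (phi n) (q ++> p)].

(** As [fo] is countable, a set of formulas is a sequence in which the other codes are filled with
    the valid formula [FoEq 0 0]. *)
Lemma saturated_set S K (G : fo -> Prop) (p : nat -> fU S) :
  saturated S -> (forall x, fD S (p x)) ->
  (forall l : seq fo, (forall psi, psi \in l -> G psi) ->
    exists q, [/\ size q = K, alls (fD S) q
      & forall psi, psi \in l -> fsat psi (q ++> p)]) ->
  exists q, [/\ size q = K, alls (fD S) q & forall psi, G psi -> fsat psi (q ++> p)].
Proof.
move=> satS Dp h.
pose phi n := if unpickle n is Some psi then if `[< G psi >] then psi else FoEq 0 0
  else FoEq 0 0.
have [|q [sq Dq H]] := satS K phi p Dp; last first.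
  exists q; split=> // psi Gpsi; have := H (pickle psi).
  by rewrite /phi pickleK asboolT.
move=> N; have [|q [sq Dq H]] := h [seq psi <- pmap unpickle (iota 0 N) | `[< G psi >]].
  by move=> psi; rewrite mem_filter => /andP[/asboolP].
exists q; split=> // n nN; rewrite /phi; case E : unpickle => [psi|] //.
case: ifPn => // Gpsi; apply: H; rewrite mem_filter Gpsi /= mem_pmap.
by rewrite -E; apply: map_f; rewrite mem_iota.
Qed.

(** Least elements are demanded only of parametrically definable sets. This is a first-order scheme,
    and not well-foundedness of the order. *)
Definition well_ordered S :=
  [/\ forall x, fD S x -> fle x x,
      forall x y, fD S x -> fD S y -> fle x y -> fle y x -> x = y,
      forall x y z, fD S x -> fD S y -> fD S z -> fle x y -> fle y z -> fle x z,
      forall x y, fD S x -> fD S y -> ~ fle x y -> fle y x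
    & forall psi (p : nat -> fU S), (forall x, fD S (p x)) ->
        (exists2 a, fD S a & fsat psi (scons a p)) ->
        exists a, [/\ fD S a, fsat psi (scons a p)
          & forall b, fD S b -> fsat psi (scons b p) -> fle a b]].

(** The names after a relation quantifier: the new variable is defined by [psi], and the old
    definitions skip the [K] parameters put in front. *)
Definition extend_defs n psi K delta : nat -> nat -> fo :=
  @scons2 (fun=> fo) n psi (dren (addn K) delta).

Lemma drel_extend S n psi K delta (p : nat -> fU S) q : size q = K ->
  radd n (fset psi (q ++> p)) (drel delta p)
  = drel (extend_defs n psi K delta) (q ++> p).
Proof.
move=> sq; rewrite -[in drel delta p](env_addn p sq) -drel_dren.
apply: rassignment_ext => m i; rewrite /extend_defs /drel.
have [<-|nm] := eqVneq n m; last first.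
  by rewrite radd_neq // (scons2_neq (F := fun=> fo)) //.
case: i => [|i].
  by rewrite radd_0 (scons2_0 (F := fun=> fo)).
by rewrite radd_S (scons2_S (F := fun=> fo)).
Qed.

(** A formula uses only finitely many parameters, which can be placed in front of any given
    assignment. A relation quantifier thus ranges over formulas and finite tuples. *)
Lemma hrel_defmodel S n X (p : nat -> fU S) : (forall x, fD S (p x)) ->
  hrel (defmodel S) n X <->
  exists psi K q, [/\ size q = K, alls (fD S) q & X = fset psi (q ++> p)].
Proof.
move=> Dp; split=> [[psi [p' [Dp' ->]]]|[psi [K [q [_ Dq ->]]]]]; last first.
  by exists psi, (q ++> p); split=> //; exact: env_in.
exists psi, (fbound psi), (mkseq p' (fbound psi)); split.
- exact: size_mkseq.
- exact: alls_mkseq.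
suff E (u : n.+1.-tuple (fU S)) :
    fsat psi (u ++> p') <-> fsat psi (u ++> mkseq p' (fbound psi) ++> p).
  by apply/seteqP; split=> u [Du /E].
apply: fsat_bound => x xb; rewrite !(env_case u).
case: ltnP => xu; first exact: set_nth_default.
have h : x - size u < fbound psi by apply: leq_ltn_trans xb; exact: leq_subr.
by rewrite (env_lt (p 0)) ?size_mkseq // nth_mkseq.
Qed.

(** Quantifying over definable relations amounts to an infinite disjunction over
    their defining formulas [psi] and numbers [K] of parameters. *)
Lemma sigma11_translation phi rho delta : sigma11 phi ->
  exists G : fo -> Prop, forall S (p : nat -> fU S), (forall x, fD S (p x)) ->
    sat (defmodel S) (p \o rho) (drel delta p) phi <-> exists psi, G psi /\ fsat psi p.
Proof.
have base psi rho' delta' : first_order psi ->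
  exists G : fo -> Prop, forall S (p : nat -> fU S), (forall x, fD S (p x)) ->
    sat (defmodel S) (p \o rho') (drel delta' p) psi <-> exists psi, G psi /\ fsat psi p.
  move=> /(fo_translation rho' delta')[f hf]; exists (eq f) => S p Dp.
  by rewrite -hf //; split=> [h|[_ [<-]] //]; exists f.
elim: phi rho delta => [x y|x y|m t xs|m t s|m t s|psi _|psi1 _ psi2 _|psi _|n phi IH]
  rho delta; do ?exact: base.
move=> /= sphi.
(* The disjunction for [phi] depends on [psi] and [K]; quantifying over every suitable [G] avoids
   choosing one for each pair. *)
exists (fun chi' => exists psi K (G : fo -> Prop) chi, [/\
   forall S (p : nat -> fU S), (forall x, fD S (p x)) ->
    sat (defmodel S) (p \o (addn K \o rho)) (drel (extend_defs n psi K delta) p) phi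
    <-> exists psi, G psi /\ fsat psi p, G chi & chi' = iter K FoEx chi]).
move=> S p Dp; split.
  move=> [X /(hrel_defmodel _ Dp)[psi [K [q [sq Dq ->]]]]].
  have [G hG] := IH (addn K \o rho) (extend_defs n psi K delta) sphi.
  rewrite (drel_extend _ _ _ _ sq) -{1}(env_addn p sq) => /hG[|chi [Gchi hchi]].
    exact: env_in.
  exists (iter K FoEx chi); split; first by exists psi, K, G, chi.
  by apply/fsat_exs; exists q.
move=> [_ [[psi [K [G [chi [hG Gchi ->]]]]] /fsat_exs[q [sq Dq hchi]]]].
exists (fset psi (q ++> p)); first by apply/(hrel_defmodel _ Dp); exists psi, K, q.
rewrite (drel_extend _ _ _ _ sq) -{1}(env_addn p sq).
by apply/hG; [exact: env_in|exists chi].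
Qed.

(** The countably many relations come with separate parameter assignments; coding triples of numbers
    merges these and the individuals into one assignment. *)
Lemma represent S (e : nat -> fU S) (r : rassignment (fU S)) :
  assignment_in (defmodel S) e r ->
  exists p rho delta, [/\ forall x, fD S (p x), e = p \o rho & r = drel delta p].
Proof.
move=> [De hr].
have /choice[f hf] : forall nk, exists c : fo * (nat -> fU S),
   (forall x, fD S (c.2 x)) /\ r nk.1 nk.2 = fset c.1 c.2.
  by move=> [n k]; have [phi [p [Dp E]]] := hr n k; exists (phi, p).
(* Tag [0] marks the individual variables, tag [n.+1] the parameters of the relation variable
   [(n, k)]. *)
pose p x := match (unpickle x : option (nat * nat * nat)) with
  | Some (n.+1, k, j) => (f (n, k)).2 j | Some (0, _, j) => e j | None => e 0 end.
exists p, (fun j => pickle (0, 0, j)),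
  (fun n k => fren (upn n.+1 (fun j => pickle (n.+1, k, j))) (f (n, k)).1); split.
- move=> x; rewrite /p; case: unpickle => [[[[|n] k] j]|]; try exact: De.
  by have [] := hf (n, k).
- by apply: funext => j; rewrite /p /= pickleK.
apply: rassignment_ext => n k; rewrite /drel fset_ren.
have [_ /= ->] := hf (n, k); congr fset.
by apply: funext => j; rewrite /p /= pickleK.
Qed.

(** The parameters are minimised one at a time, starting with the last one. *)
Lemma uniformize K chi : exists chi', forall S (p : nat -> fU S),
  well_ordered S -> (forall x, fD S (p x)) ->
  (exists q, [/\ size q = K, alls (fD S) q & fsat chi (q ++> p)]) ->
  exists q, [/\ size q = K, alls (fD S) q, fsat chi (q ++> p) &
   forall q', size q' = K -> alls (fD S) q' -> fsat chi' (q' ++> p) <-> q' = q].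
Proof.
elim: K => [|K [chi0 h0]].
  exists (FoEq 0 0) => S p _ _ [[|a q] []] // _ _ h; exists [::]; split=> // q' /size0nil -> _.
  by split.
pose A := iter K FoEx chi.
(* [L] says that variable [0] is the least last parameter that can be completed to a tuple
   satisfying [chi]. In [chi'] this variable sits at index [K], while [chi0] determines the other
   parameters relative to it. *)
have [L hL] := fodef_and (fodef_fsat A)
  (fodef_all (fodef_imp (fodef_ren (scons 0 (addn 2)) (fodef_fsat A)) (fodef_fsat (FoLe 1 0)))).
have [chi' h'] := fodef_and (fodef_fsat chi0) (fodef_ren (addn K) (fodef_fsat L)).
exists chi' => S p wS Dp [q1 [sq1 Dq1 hq1]].
have [_ asym _ _ /(_ A p Dp)[|a [Da Aa amin]]] := wS.
  case/lastP: q1 sq1 Dq1 hq1 => // q a; rewrite size_rcons => -[sq] /alls_rcons[Dq Da].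
  by rewrite -cats1 env_cat => hq; exists a => //; apply/fsat_exs; exists q.
have [q [sq Dq hq uq]] := h0 S (scons a p) wS (scons_in Da Dp) ((fsat_exs _ _ _).1 Aa).
exists (rcons q a); split.
- by rewrite size_rcons sq.
- exact/alls_rcons.
- by rewrite -cats1 env_cat.
move=> q'; case/lastP: q' => // q' b; rewrite size_rcons => -[sq'] /alls_rcons[Dq' Db].
have Dbp := scons_in Db Dp.
rewrite h'; last by apply: env_in => //; apply/alls_rcons.
rewrite -cats1 env_cat env_addn // [_ ++> p]/= hL //.
have E c : scons c (scons b p) \o scons 0 (addn 2) = scons c p.
  by apply: funext => -[|x].
split=> [[hq' [Ab bmin]]|].
  have ab : b = a.
    by apply: asym => //; [apply: bmin => //; rewrite E|exact: amin].
  by move: hq'; rewrite ab uq // => ->; rewrite cats1.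
rewrite cats1 => /rcons_inj[? ?]; subst q' b; split; first by apply/uq.
by split=> // c Dc; rewrite E; exact: amin.
Qed.

Definition swap a b x := if x < b then a + x else if x < b + a then x - b else x.

Lemma env_swap T (q y : seq T) p a b : size q = a -> size y = b ->
  (q ++> y ++> p) \o swap a b = y ++> q ++> p.
Proof.
move=> <- <-; apply: funext => x; rewrite /= /swap [RHS]env_case.
case: ltnP => yx; first by rewrite env_ge (env_lt ((q ++> p) 0)).
case: ltnP => qx.
  have h : x - size y < size q by rewrite ltn_subLR.
  by rewrite !(env_lt (p 0)).
rewrite -(subnKC qx); move: (x - _) => k.
by rewrite -addnA addKn env_ge addnCA !env_ge.
Qed.

Lemma sat_choice_subst U (M : henkin U) m n (R : set ((m + n.+1).+1.-tuple U)) e r phi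
    (s : m.+1.-tuple U) :
  sat M (s ++> e) (radd (m + n.+1) R r) (fsubst
          (@scons2 (fun k => rterm k.+1) n
             (@RSec m n (RVar (m + n.+1) 0) (ivars m.+1))
             (lift2 (m + n.+1)))
          phi)
  <-> sat M (s ++> e)
    (radd n [set y | R (cat_tuple s y : (m.+1 + n.+1).-tuple U)] r) phi.
Proof.
rewrite sat_subst; set r1 := fun k i => _.
suff -> : r1 = radd n [set y | R (cat_tuple s y : (m.+1 + n.+1).-tuple U)] r by [].
apply: radd_eq; rewrite /r1.
- rewrite (scons2_0 (F := fun k => rterm k.+1)); apply/seteqP; split=> y;
  by rewrite /= radd_0 map_ivars.
- move=> i; rewrite (scons2_S (F := fun k => rterm k.+1)).
  exact: radd_shift.
- move=> k i nk; rewrite (scons2_neq (F := fun k => rterm k.+1)) //.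
  exact: radd_shift.
Qed.

(** * The definable relations satisfy the axioms *)

Section ModelOfTheory.
Variable S : fstruct.
Hypotheses (satS : saturated S) (woS : well_ordered S).

Lemma defmodel_comprehension n phi e r : first_order phi ->
  assignment_in (defmodel S) e r ->
  exists2 X, hrel (defmodel S) n X & forall s : n.+1.-tuple (fU S), alls (fD S) s ->
    X s <-> sat (defmodel S) (s ++> e) r phi.
Proof.
move=> fphi /represent[p [rho [delta [Dp -> ->]]]].
have [psi hpsi] := fo_translation (upn n.+1 rho) (dren (addn n.+1) delta) fphi.
exists (fset psi p); first by exists psi, p.
move=> s Ds; rewrite -(env_upn p rho (size_tuple s)) -[in drel delta p](env_addn p (size_tuple s)).
rewrite -drel_dren -hpsi; last exact: env_in.
by split=> [[]|].
Qed.

(** Finitely many definitions suffice for all [s], because otherwise saturation would yield an [s]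
    without a witness. They are merged into one formula that uses the first definition applicable to
    [s], with least parameters. *)
Lemma defmodel_choice m n phi e r : sigma11 phi ->
  assignment_in (defmodel S) e r ->
  (forall s, size s = m.+1 -> alls (fD S) s ->
     exists2 X, hrel (defmodel S) n X & sat (defmodel S) (s ++> e) (radd n X r) phi) ->
  exists2 R : set ((m.+1 + n.+1).-tuple (fU S)), hrel (defmodel S) (m + n.+1) R
    & forall s : m.+1.-tuple (fU S), alls (fD S) s ->
      sat (defmodel S) (s ++> e) (radd n [set y | R (cat_tuple s y)] r) phi.
Proof.
move=> sphi /represent[p [rho [delta [Dp -> ->]]]] hyp.
pose rho' K := addn K \o upn m.+1 rho.
pose delta' psi K := extend_defs n psi K (dren (addn m.+1) delta).
(* [chi] is a first-order certificate: any parameters satisfying it make [psi] define a witness for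
   [s]. *)
pose good psi K chi := forall s q, size s = m.+1 -> alls (fD S) s ->
  size q = K -> alls (fD S) q -> fsat chi (q ++> s ++> p) ->
  sat (defmodel S) (s ++> p \o rho) (radd n (fset psi (q ++> s ++> p)) (drel delta p)) phi.
(* A formula of [Gam] says of [s] that some certificate applies to no parameters. By [cover], no [s]
   satisfies all of them. *)
pose Gam f := exists psi K chi, good psi K chi /\ f = FoNot (iter K FoEx chi).
have cover s : size s = m.+1 -> alls (fD S) s -> exists f, Gam f /\ ~ fsat f (s ++> p).
  move=> ss Ds; have Dsp := env_in Ds Dp.
  have [X /(hrel_defmodel _ Dsp)[psi [K [q [sq Dq ->]]]]] := hyp s ss Ds.
  have [G hG] := sigma11_translation (rho' K) (delta' psi K) sphi.
  have E s' q' : size s' = m.+1 -> size q' = K ->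
    sat (defmodel S) (s' ++> p \o rho) (radd n (fset psi (q' ++> s' ++> p)) (drel delta p)) phi
    <-> sat (defmodel S) ((q' ++> s' ++> p) \o rho' K) (drel (delta' psi K) (q' ++> s' ++> p)) phi.
    move=> ss' sq'; rewrite /rho' /delta' -drel_extend // drel_dren env_addn //.
    suff -> : s' ++> p \o rho = (q' ++> s' ++> p) \o (addn K \o upn m.+1 rho) by [].
    by rewrite -(env_upn p rho ss') -[in LHS](env_addn (s' ++> p) sq').
  rewrite E // hG; last exact: env_in.
  move=> [chi [Gchi hchi]]; exists (FoNot (iter K FoEx chi)); split.
    exists psi, K, chi; split=> // s' q' ss' Ds' sq' Dq' hchi'.
    by apply/E => //; apply/hG; [do 2?apply: env_in|exists chi].
  by move=> /=; apply; apply/fsat_exs; exists q.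
(* If no finite list covered every [s], then [Gam] would be finitely satisfiable and hence, by
   saturation, satisfied by a single [s]. *)
have [l lG lcov] : exists2 l : seq fo, (forall f, f \in l -> Gam f) &
    forall s, size s = m.+1 -> alls (fD S) s ->
      exists f, f \in l /\ ~ fsat f (s ++> p).
  apply: contrapT => nl.
  have [|s [ss Ds hs]] := @saturated_set S m.+1 Gam p satS Dp.
    move=> l lG; apply: contrapT => nex; apply: nl; exists l => // s ss Ds.
    apply: contrapT => nf; apply: nex; exists s; split=> // f fl.
    by apply: contrapT => nsat; apply: nf; exists f.
  by have [f [/hs]] := cover s ss Ds.
(* By induction on the list: if the head certificate applies to [s], its definition is used, and
   otherwise the formula for the tail. *)
have [xi hxi] : exists xi, forall s, size s = m.+1 -> alls (fD S) s ->
    (exists f, f \in l /\ ~ fsat f (s ++> p)) ->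
    sat (defmodel S) (s ++> p \o rho) (radd n (fset xi (s ++> p)) (drel delta p)) phi.
  elim: l lG {lcov} => [|f l IH] lG.
    by exists (FoEq 0 0) => s _ _ [f []].
  have [|xi hxi] := IH; first by move=> g gl; apply: lG; rewrite inE gl orbT.
  have [psi [K [chi [gd fE]]]] := lG f (mem_head _ _).
  have [chi' hchi'] := uniformize K chi.
  pose E := iter K FoEx chi.
  (* In scope are the parameters, the argument [y] and then [s]: [chi'] skips [y], and the swap
     moves [y] to the front for [psi]. *)
  have [ex hex] := fodef_exs K (fodef_and (fodef_ren (upn K (addn n.+1)) (fodef_fsat chi'))
    (fodef_ren (swap K n.+1) (fodef_fsat psi))).
  have [xi' hxi'] := fodef_or
    (fodef_and (fodef_ren (addn n.+1) (fodef_fsat E)) (fodef_fsat ex))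
    (fodef_and (fodef_ren (addn n.+1) (fodef_not (fodef_fsat E))) (fodef_fsat xi)).
  exists xi' => s ss Ds [g [gl ng]]; have Dsp := env_in Ds Dp.
  have hset (y : n.+1.-tuple (fU S)) : alls (fD S) y ->
     fsat xi' (y ++> s ++> p) <-> (fsat E (s ++> p) /\ fsat ex (y ++> s ++> p)) \/
        (~ fsat E (s ++> p) /\ fsat xi (y ++> s ++> p)).
    by move=> Dy; rewrite hxi' ?env_addn ?size_tuple //; exact: env_in.
  have [hE|nE] := pselect (fsat E (s ++> p)); last first.
    suff -> : fset xi' (s ++> p) = fset xi (s ++> p) :> set (n.+1.-tuple _).
      apply: hxi => //; exists g; split=> //; move: gl; rewrite inE => /predU1P[gf|//].
      by case: ng; rewrite gf fE.
    apply/seteqP; split=> y [Dy h]; split=> //; last by apply/hset => //; right.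
    by move/(hset _ Dy): h => -[[]|[]].
  have [q [sq Dq hq uq]] := hchi' S (s ++> p) woS Dsp ((fsat_exs _ _ _).1 hE).
  suff -> : fset xi' (s ++> p) = fset psi (q ++> s ++> p) :> set (n.+1.-tuple _).
    exact: gd.
  have hexE (y : n.+1.-tuple (fU S)) : alls (fD S) y ->
      fsat ex (y ++> s ++> p) <-> fsat psi (y ++> q ++> s ++> p).
    move=> Dy; rewrite hex; last exact: env_in.
    split=> [[q' [sq' Dq']]|h]; last first.
      exists q; split=> //; rewrite env_upn // env_addn ?size_tuple // env_swap ?size_tuple //.
      by split=> //; exact/uq.
    rewrite env_upn // env_addn ?size_tuple // env_swap ?size_tuple // => -[/uq h].
    by rewrite h.
  apply/seteqP; split=> y [Dy h]; split=> //.
    by move/(hset _ Dy): h => -[[_ /(hexE _ Dy)]|[]].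
  by apply/hset => //; left; split=> //; exact/hexE.
(* The choice relation takes [s] before [y], whereas [xi] expects [y] first. *)
exists (fset (fren (swap m.+1 n.+1) xi) p); first by eexists; exists p.
move=> s Ds.
have -> : [set y | fset (fren (swap m.+1 n.+1) xi) p (cat_tuple s y)] = fset xi (s ++> p) :> set (n.+1.-tuple _).
  apply/seteqP; split=> y; rewrite /fset /= alls_cat env_cat.
    by rewrite fsat_ren env_swap ?size_tuple // => -[[]].
  by rewrite fsat_ren env_swap ?size_tuple // => -[].
by apply: hxi; rewrite ?size_tuple //; apply: lcov; rewrite ?size_tuple.
Qed.

Lemma defmodel_is_model : is_model (defmodel S) Sigma11_AC0_wo.
Proof.
have [wrefl wasym wtrans wtot wmin] := woS.
move=> _ []; rewrite /holds.
- move=> n e r _; apply/sat_all2 => X hX; apply/sat_all2 => Y hY; apply/sat_imp.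
  move=> /sat_alls h /=; rewrite radd_0 radd_S radd_0.
  have HE (s : n.+1.-tuple (fU S)) : alls (fD S) s -> X s <-> Y s.
    move=> Ds; have /sat_iff := h s (size_tuple s) Ds.
    by rewrite /= radd_0 radd_S radd_0 map_ivars.
  apply/seteqP; split=> s hs; apply/HE => //; apply/alls_tnth;
    exact: (@hrel_sub _ (defmodel S)) hs.
- move=> n phi fphi e r her.
  have [X hX XE] := defmodel_comprehension n fphi her.
  exists X => //; apply/sat_alls => s /eqP ss Ds; apply/sat_iff.
  rewrite sat_lift2 /= radd_0 -[s]/(tval (Tuple ss)) map_ivars.
  exact: XE.
- move=> m n phi sphi e r her; apply/sat_imp => /sat_alls h.
  have [R hR RE] := defmodel_choice sphi her h.
  exists R => //; apply/sat_alls => s /eqP ss Ds.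
  by rewrite -[s]/(tval (Tuple ss)); apply/sat_choice_subst; exact: RE.
- by move=> e r _; apply/sat_all1 => a Da; split=> //; exact: wrefl.
- move=> e r _; apply/sat_all1 => a Da; apply/sat_all1 => b Db; apply/sat_imp.
  by move=> [[_ _ ab] [_ _ ba]]; exact: wasym.
- move=> e r _; apply/sat_all1 => a Da; apply/sat_all1 => b Db; apply/sat_all1 => c Dc.
  apply/sat_imp => -[[_ _ ab] [_ _ bc]]; split=> //; exact: wtrans ab bc.
- move=> e r _; apply/sat_all1 => a Da; apply/sat_all1 => b Db.
  apply/sat_imp => /= nab; split=> //; apply: wtot => // ab; exact: nab.
- move=> e r _; apply/sat_all2 => X [psi [p [Dp ->]]]; apply/sat_imp.
  have E a : radd 0 (fset psi p) r 0 0 [tuple a] <-> fD S a /\ fsat psi (scons a p).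
    by rewrite (radd_0 (fset psi p) r) /fset /=; tauto.
  have tE (a : fU S) e' : map_tuple (scons a e') [tuple 0] = [tuple a].
    by apply: val_inj.
  move=> [a Da /=]; rewrite tE => /E[_ ha].
  have [|b [Db hb bmin]] := wmin psi p Dp; first by exists a.
  exists b => //; split; first by rewrite /= tE; exact: (E b).2.
  move=> [c Dc]; apply=> /=; rewrite tE => -[/E[_ hc]]; apply.
  by split=> //; exact: bmin.
Qed.

End ModelOfTheory.

(** * Back and forth *)

Definition fo_equiv S S' (p : nat -> fU S) (p' : nat -> fU S') :=
  forall phi, fsat phi p <-> fsat phi p'.

(** The type of [q] over [p] is finitely satisfiable over [p'], because existence of a tuple
    satisfying a finite conjunction is itself a formula; saturation then realises it. *)
Lemma fo_equiv_extend S S' (p : nat -> fU S) (p' : nat -> fU S') q :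
  saturated S' -> (forall x, fD S (p x)) -> (forall x, fD S' (p' x)) ->
  fo_equiv p p' -> alls (fD S) q ->
  exists q', [/\ size q' = size q, alls (fD S') q' & fo_equiv (q ++> p) (q' ++> p')].
Proof.
move=> sat' Dp Dp' pp' Dq.
have [|q' [sq' Dq' h]] := @saturated_set S' (size q) (fun phi => fsat phi (q ++> p)) p' sat' Dp'.
  move=> l hl.
  have [f hf] := fo_conjunction l.
  have /pp'/fsat_exs[q' [sq' Dq' hq']] : fsat (iter (size q) FoEx f) p.
    by apply/fsat_exs; exists q; split=> //; exact/hf.
  by exists q'; split=> //; exact/hf.
exists q'; split=> // phi; split=> [|h']; first exact: h.
by apply: contrapT => nphi; have := h (FoNot phi) nphi.
Qed.

(** A relation is matched with the one given by the same formula at matching parameters, so both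
    sides keep the same [delta]. One implication is enough, as the negation case exchanges the
    structures. *)
Lemma back_and_forth phi : forall S S' (p : nat -> fU S) (p' : nat -> fU S') rho delta,
  saturated S -> saturated S' ->
  (forall x, fD S (p x)) -> (forall x, fD S' (p' x)) -> fo_equiv p p' ->
  sat (defmodel S) (p \o rho) (drel delta p) phi ->
  sat (defmodel S') (p' \o rho) (drel delta p') phi.
Proof.
have base psi S S' (p : nat -> fU S) (p' : nat -> fU S') rho delta : first_order psi ->
  (forall x, fD S (p x)) -> (forall x, fD S' (p' x)) -> fo_equiv p p' ->
  sat (defmodel S) (p \o rho) (drel delta p) psi ->
  sat (defmodel S') (p' \o rho) (drel delta p') psi.
  move=> /(fo_translation rho delta)[f hf] Dp Dp' pp'.
  by move=> /(hf _ _ Dp)/pp'/(hf _ _ Dp').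
elim: phi => [x y|x y|n t xs|n t s|n t s|psi IH|psi1 IH1 psi2 IH2|psi IH|n psi IH]
  S S' p p' rho delta sS sS' Dp Dp' pp'; do ?exact: base.
- move=> /= h h'; apply: h; apply: (IH S' S p' p) h' => // phi.
  exact: iff_sym (pp' phi).
- move=> [h1 h2]; split; [exact: (IH1 S S' p)|exact: (IH2 S S' p)].
- move=> [a Da ha].
  have [q] := fo_equiv_extend (q := [:: a]) sS' Dp Dp' pp' (conj Da I).
  case: q => [|b [|? ?]] [] // _ [Db _] eqv.
  exists b => //; move: ha; rewrite -scons_up -[drel _ p]/(drel delta (scons a p \o succn)).
  rewrite -drel_dren => /(IH S S' _ (scons b p')) h.
  rewrite -scons_up -[drel _ p']/(drel delta (scons b p' \o succn)) -drel_dren.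
  by apply: h => //; exact: scons_in.
- move=> [X /(hrel_defmodel _ Dp)[f [K [q [sq Dq ->]]]]].
  have [q' [sq' Dq' eqv]] := fo_equiv_extend sS' Dp Dp' pp' Dq.
  rewrite sq in sq'.
  rewrite (drel_extend _ _ _ _ sq) -{1}(env_addn p sq) => h.
  exists (fset f (q' ++> p')); first by apply/(hrel_defmodel _ Dp'); exists f, K, q'.
  rewrite (drel_extend _ _ _ _ sq') -{1}(env_addn p' sq').
  by apply: (IH S S' _ _ (addn K \o rho)) h => //; exact: env_in.
Qed.

(** * Ultraproducts of Henkin models *)

Lemma dependent_choice (I : Type) (U : I -> Type) (P : forall i, U i -> Prop) :
  (forall i, exists x, P i x) -> exists f : forall i, U i, forall i, P i (f i).
Proof. by move=> h; exists (fun i => sval (cid (h i))) => i; case: cid. Qed.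

Section Ultraproduct.
Variables (W : set_system nat) (UW : UltraFilter W).
Hypothesis W_cofinite : forall N, W [set n | N <= n].
Variables (U : nat -> Type) (M : forall i, henkin (U i)).

Let PW : ProperFilter W := ultra_proper.
Let FW : Filter W := PW.

Lemma ae_mono (P Q : nat -> Prop) : (forall i, P i -> Q i) -> W P -> W Q.
Proof. by move=> PQ; apply: filterS. Qed.

Lemma ae_all (P : nat -> Prop) : (forall i, P i) -> W P.
Proof. by move=> h; apply: filterS (@filterT _ W FW). Qed.

Lemma ae_false : ~ W (fun=> False).
Proof. exact: (@filter_not_empty _ W PW). Qed.

Lemma ae_and (P Q : nat -> Prop) : W (fun i => P i /\ Q i) <-> W P /\ W Q.
Proof.
split=> [h|[hP hQ]]; last exact: (@filterI _ W FW P Q).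
by split; apply: ae_mono h => i [].
Qed.

Lemma ae_not (P : nat -> Prop) : W (fun i => ~ P i) <-> ~ W P.
Proof.
split=> [nP hP|nP].
  have := (ae_and _ _).2 (conj hP nP).
  rewrite (_ : (fun i => _) = set0) => [|]; first exact: filter_not_empty.
  by apply/seteqP; split=> // i [].
by have [//|] := in_ultra_setVsetC P UW.
Qed.

Lemma ae_or (P Q : nat -> Prop) : W (fun i => P i \/ Q i) <-> W P \/ W Q.
Proof.
split=> [h|[] h]; [|by apply: ae_mono h; left|by apply: ae_mono h; right].
have [hP|/ae_not nP] := pselect (W P); first by left.
by right; apply: ae_mono ((ae_and _ _).2 (conj h nP)) => i [[]].
Qed.

Lemma ae_imp (P Q : nat -> Prop) : W P -> W (fun i => P i -> Q i) -> W Q.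
Proof.
by move=> hP h; apply: ae_mono ((ae_and _ _).2 (conj hP h)) => i [hi]; apply.
Qed.

Lemma ae_iff (P Q : nat -> Prop) : W (fun i => P i <-> Q i) -> W P <-> W Q.
Proof.
move=> h; split=> hP; apply: ae_imp hP _; apply: ae_mono h => i [] //.
Qed.

Lemma ae_exists_fin (I : finType) (P : I -> nat -> Prop) :
  W (fun i => exists k, P k i) -> exists k, W (P k).
Proof.
move=> h; apply: contrapT => nk.
have : W (fun i => forall k, ~ P k i).
  apply: (@filter_forall nat I (fun k => [set i | ~ P k i]) W FW) => k.
  by apply/ae_not => hk; apply: nk; exists k.
move=> h'; apply: ae_false.
by apply: ae_mono ((ae_and _ _).2 (conj h h')) => i [[k Pk] /(_ k)].
Qed.

Definition pr i (f : forall i, U i) : U i := f i.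

(** Elements of the ultraproduct are represented by chosen members of their
    classes, so that no quotient type is needed. *)
Definition pick_dom (A : set (forall i, U i)) : forall i, U i :=
  if pselect (A !=set0) is left h then sval (cid h)
  else fun i => sval (cid (hdom_nonempty (M i))).

Definition rep f := pick_dom [set g | (forall i, hdom (M i) (g i)) /\ W (fun i => f i = g i)].

Definition uhdom f := (forall i, hdom (M i) (f i)) /\ rep f = f.

Lemma rep_spec f : W (fun i => hdom (M i) (f i)) ->
  (forall i, hdom (M i) (rep f i)) /\ W (fun i => f i = rep f i).
Proof.
move=> hf; rewrite /rep /pick_dom; case: pselect => [h|[]]; first exact: (svalP (cid h)).
have [g hg] : exists g : forall i, U i, forall i, hdom (M i) (g i) /\
    (hdom (M i) (f i) -> f i = g i).
  apply: (@dependent_choice _ _ (fun i x => hdom (M i) x /\ (hdom (M i) (f i) -> f i = x))) => i.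
  have [fi|nfi] := pselect (hdom (M i) (f i)).
    by exists (f i).
  by have [a ha] := hdom_nonempty (M i); exists a.
exists g; split=> [i|]; first by have [] := hg i.
by apply: ae_mono hf => i; have [_] := hg i.
Qed.

(** The choice depends on the class alone, and equivalent functions have the same class. *)
Lemma rep_eq f g : W (fun i => f i = g i) -> rep f = rep g.
Proof.
move=> fg; rewrite /rep; congr pick_dom; apply/seteqP; split=> h [hd hE]; split=> //.
  by apply: ae_mono ((ae_and _ _).2 (conj fg hE)) => i [<-].
by apply: ae_mono ((ae_and _ _).2 (conj fg hE)) => i [->].
Qed.

Lemma uhdom_eq f g : uhdom f -> uhdom g -> W (fun i => f i = g i) -> f = g.
Proof. by move=> [_ fE] [_ gE] /rep_eq; rewrite fE gE. Qed.

Lemma lift_dom (f : forall i, U i) : W (fun i => hdom (M i) (f i)) ->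
  exists2 g, uhdom g & W (fun i => g i = f i).
Proof.
move=> /rep_spec[hd hE]; exists (rep f); last exact: ae_mono hE.
by split=> //; rewrite -(rep_eq hE).
Qed.

Lemma lift_tuple n (a : forall i, n.-tuple (U i)) :
  W (fun i => alls (hdom (M i)) (a i)) ->
  exists2 t : n.-tuple (forall i, U i), alls uhdom t
    & W (fun i => map_tuple (pr i) t = a i).
Proof.
move=> Da.
have /dependent_choice[g hg] (k : 'I_n) : exists g, uhdom g /\ W (fun i => g i = tnth (a i) k).
  have [|g gd gE] := @lift_dom (fun i => tnth (a i) k); last by exists g.
  by apply: ae_mono Da => i /alls_tnth.
exists [tuple g k | k < n].
  by apply/alls_tnth => k; rewrite tnth_mktuple; have [] := hg k.
have : W (fun i => forall k, g k i = tnth (a i) k).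
  apply: (@filter_forall nat 'I_n (fun k => [set i | g k i = tnth (a i) k]) W FW) => k.
  by have [] := hg k.
apply: ae_mono => i h; apply: eq_from_tnth => k.
by rewrite tnth_map tnth_mktuple /pr h.
Qed.

Definition internal n (X : forall i, set (n.-tuple (U i))) : set (n.-tuple (forall i, U i)) :=
  [set t : n.-tuple _ | alls uhdom t /\ W (fun i => X i (map_tuple (pr i) t))].

Program Definition ultraproduct : henkin (forall i, U i) :=
  @Henkin _ uhdom
    (fun n => [set Y | exists2 X : forall i, set (n.+1.-tuple (U i)),
      forall i, hrel (M i) n (X i) & Y = internal X])
    (fun f g => [/\ uhdom f, uhdom g & W (fun i => hle (M i) (f i) (g i))]) _ _ _ _.
Next Obligation.
have [|g hg _] := @lift_dom (fun i => sval (cid (hdom_nonempty (M i)))); last by exists g.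
by apply: ae_all => i; case: cid.
Qed.
Next Obligation.
move=> n.
have [X hX] := dependent_choice (fun i => hrel_nonempty (M i) n).
by exists (internal X); exists X.
Qed.
Next Obligation. by move=> n Y [X _ ->] t [/alls_tnth]. Qed.
Next Obligation. by move=> f g []. Qed.

Lemma alls_pr i s : alls uhdom s -> alls (hdom (M i)) (map (pr i) s).
Proof. by elim: s => //= f s IH [[fd _] /IH]. Qed.

(** A preimage is assembled from componentwise ones; components that have none receive an arbitrary
    tuple of their domain. *)
Lemma internal_proj n (k : 'I_n) (X : forall i, set (n.-tuple (U i))) u :
  (forall i a, X i a -> alls (hdom (M i)) a) ->
  (exists2 a, internal X a & thead u = tnth a k)
  <-> internal (fun i => [set u : 1.-tuple _ | exists2 a, X i a & thead u = tnth a k]) u.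
Proof.
move=> XD; split.
  move=> [a [Da ta] ua]; split.
    by apply/alls_tnth => j; rewrite ord1 -[tnth u _]/(thead u) ua; move/alls_tnth: Da.
  apply: ae_mono ta => i ta; exists (map_tuple (pr i) a) => //.
  by rewrite tnth_map -ua /thead tnth_map.
move=> [/alls_tnth Du h].
have [|a ha] := @dependent_choice _ _ (fun i (a : n.-tuple (U i)) => alls (hdom (M i)) a /\
   ((exists2 a, X i a & thead (map_tuple (pr i) u) = tnth a k) ->
    X i a /\ thead (map_tuple (pr i) u) = tnth a k)); last first.
  have [|t Dt tE] := @lift_tuple n a; first by apply: ae_all => i; have [] := ha i.
  have E : W (fun i => X i (a i) /\ thead (map_tuple (pr i) u) = tnth (a i) k).
    by apply: ae_mono h => i; have [_] := ha i.
  exists t; first split=> //.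
    by apply: ae_mono ((ae_and _ _).2 (conj tE E)) => i [-> []].
  apply: uhdom_eq; [exact: Du|by move/alls_tnth: Dt|].
  apply: ae_mono ((ae_and _ _).2 (conj tE E)) => i [<- [_]].
  by rewrite /thead !tnth_map.
move=> i; have [[a Xa ua]|nex] := pselect (exists2 a, X i a & thead (map_tuple (pr i) u) = tnth a k).
  by exists a; split=> //; exact: XD Xa.
have [d hd] := hdom_nonempty (M i); exists [tuple d | _ < n]; split=> //.
by apply/alls_tnth => j; rewrite tnth_mktuple.
Qed.

(** * The theorem of Łoś *)

Section Los.
Variable R : forall n (k : nat) i, set (n.+1.-tuple (U i)).
Arguments R : clear implicits.
Hypothesis hR : forall n k i, hrel (M i) n (R n k i).

Let ur : rassignment (forall i, U i) := fun n k => internal (R n k).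
Let Ri i : rassignment (U i) := fun n k => R n k i.
Arguments Ri : clear implicits.
Arguments ur : clear implicits.

Lemma Ri_dom i e n (t : rterm n) u : teval e (Ri i) t u -> alls (hdom (M i)) u.
Proof. by apply: teval_dom => m k v /(hrel_sub (hR _ k i)) h; apply/alls_tnth. Qed.

Lemma pr_cat i m n (a : m.-tuple (forall i, U i)) (b : n.-tuple (forall i, U i)) :
  map_tuple (pr i) (cat_tuple a b) = cat_tuple (map_tuple (pr i) a) (map_tuple (pr i) b).
Proof. by apply: val_inj; rewrite /= map_cat. Qed.

Lemma pr_args i e n (xs : n.-tuple nat) :
  map_tuple (pr i) (map_tuple e xs) = map_tuple (pr i \o e) xs.
Proof. by apply: val_inj; rewrite /= -map_comp. Qed.

(** Differences and unions use that [W] is an ultrafilter, powers and fields that arities are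
    finite, and projections that witnesses can be chosen componentwise. *)
Lemma los_term n (t : rterm n) e : (forall x, uhdom (e x)) ->
  teval e ur t = internal (fun i => teval (pr i \o e) (Ri i) t).
Proof.
move=> De; elim: n / t => //=.
- by move=> n; apply/seteqP; split=> // u [_ /ae_false].
- move=> n t -> s ->; apply/seteqP; split=> u.
    by move=> [[Du tu] [_ su]]; split=> //; exact/ae_and.
  by move=> [Du /ae_and[tu su]].
- move=> n t -> s ->; apply/seteqP; split=> u.
    by move=> [] [Du h]; split=> //; apply/ae_or; [left|right].
  by move=> [Du /ae_or[] h]; [left|right].
- move=> n t -> s ->; apply/seteqP; split=> u.
    by move=> [[Du tu] nsu]; split=> //; apply/ae_and; split=> //; apply/ae_not => su; apply: nsu.
  by move=> [Du /ae_and[tu /ae_not su]]; split=> // -[].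
- move=> m n t -> s ->; apply/seteqP; split=> u.
    move=> [a [b [[Da ta] [Db sb] ->]]]; split; first exact/alls_cat.
    apply: ae_mono ((ae_and _ _).2 (conj ta sb)) => i [tai sbi].
    by rewrite pr_cat; do 2 eexists; split; [exact: tai|exact: sbi|].
  have [a [b ->]] := tuple_split u; move=> [/alls_cat[Da Db] h].
  exists a, b; split=> //; split=> //; apply: ae_mono h => i [a' [b' [ta sb]]];
  by rewrite pr_cat => /cat_tuple_inj[aE bE]; rewrite ?aE ?bE.
- move=> n t ->; apply/seteqP; split=> u.
    move=> h; split; first by apply/alls_tnth => k; have [[]] := h k.
    apply: (@filter_forall nat 'I_n.+1 (fun k => [set i | teval (pr i \o e) (Ri i) t
      [tuple tnth (map_tuple (pr i) u) k]]) W FW) => k.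
    have [_] := h k; apply: ae_mono => i /=.
    by rewrite (_ : map_tuple _ _ = [tuple tnth (map_tuple (pr i) u) k]) //;
      apply: val_inj; rewrite /= tnth_map.
  move=> [/alls_tnth Du h] k; split=> //=; apply: ae_mono h => i /(_ k).
  by rewrite (_ : map_tuple _ [tuple _] = [tuple tnth (map_tuple (pr i) u) k]) //;
    apply: val_inj; rewrite /= tnth_map.
- move=> n k t ->; have XD i := @Ri_dom i (pr i \o e) n t.
  by apply/seteqP; split=> u /(internal_proj k u XD).
- move=> n t ->; have XD i := @Ri_dom i (pr i \o e) n t.
  apply/seteqP; split=> u.
    move=> [k /(internal_proj k u XD)[Du h]]; split=> //.
    by apply: ae_mono h => i [a ta ua]; exists k, a.
  by move=> [Du /ae_exists_fin[k hk]]; exists k; apply/(internal_proj k u XD).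
- move=> m n t -> xs; apply/seteqP; split=> u.
    move=> [/alls_cat[_ Du] h]; split=> //; apply: ae_mono h => i.
    by rewrite pr_cat pr_args.
  move=> [Du h]; split.
    apply/alls_cat; split=> //; apply/alls_tnth => k; rewrite tnth_map; exact: De.
  by apply: ae_mono h => i; rewrite pr_cat pr_args.
Qed.
End Los.

Definition rfamily := forall i, rassignment (U i).

Definition internal_rel (R : rfamily) : rassignment (forall i, U i) :=
  fun n k => internal (fun i => R i n k).

Definition rfamily_in (R : rfamily) := forall i n k, hrel (M i) n (R i n k).

(** If inclusion fails on a set of [W], counterexamples chosen there form a tuple of the
    ultraproduct that separates the internal relations. *)
Lemma internal_sub n (X Y : forall i, set (n.-tuple (U i))) :
  (forall i u, X i u -> alls (hdom (M i)) u) ->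
  internal X `<=` internal Y <-> W (fun i => X i `<=` Y i).
Proof.
move=> XD; split=> [h|h u [Du Xu]]; last first.
  split=> //; apply: ae_mono ((ae_and _ _).2 (conj h Xu)) => i [XY].
  exact: XY.
apply: contrapT => /ae_not nXY.
have [i|a ha] := @dependent_choice _ _ (fun i (a : n.-tuple (U i)) => alls (hdom (M i)) a /\
   (~ (X i `<=` Y i) -> X i a /\ ~ Y i a)).
  have [XY|/existsNP[a /not_implyP[Xa nYa]]] := pselect (X i `<=` Y i).
    have [d hd] := hdom_nonempty (M i); exists [tuple d | _ < n]; split=> //.
    by apply/alls_tnth => j; rewrite tnth_mktuple.
  by exists a; split=> //; exact: XD Xa.
have [|t Dt tE] := @lift_tuple n a; first by apply: ae_all => i; have [] := ha i.
have E : W (fun i => X i (a i) /\ ~ Y i (a i)).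
  by apply: ae_mono nXY => i; have [_] := ha i.
have [_ Yt] : internal Y t.
  by apply: h; split=> //; apply: ae_mono ((ae_and _ _).2 (conj tE E)) => i [-> []].
apply: ae_false.
by apply: ae_mono ((ae_and _ _).2 (conj Yt ((ae_and _ _).2 (conj tE E)))) => i [Yti [tEi [_]]]; rewrite -tEi.
Qed.

Lemma pr_scons i a e : pr i \o scons a e = scons (a i) (pr i \o e).
Proof. by apply: funext => -[|x]. Qed.

Lemma pr_env i s e : pr i \o (s ++> e) = map (pr i) s ++> (pr i \o e).
Proof. by elim: s => //= a s IH; rewrite pr_scons IH. Qed.

(** Relation quantifiers are treated like individual ones, since the relations of the ultraproduct
    are exactly the internal ones and witnesses can be chosen in each component. *)
Lemma los phi e R : (forall x, uhdom (e x)) -> rfamily_in R ->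
  sat ultraproduct e (internal_rel R) phi <-> W (fun i => sat (M i) (pr i \o e) (R i) phi).
Proof.
elim: phi e R => /= [x y|x y|n t xs|n t s|n t s|p IH|p IHp q IHq|p IH|n p IH] e R De hR;
  have hR' n0 k0 i : hrel (M i) n0 (R i n0 k0) := hR i n0 k0.
- split=> [->|]; first exact: ae_all.
  exact: (uhdom_eq (De x) (De y)).
- split=> [[]|h] //; split=> //; exact: De.
- rewrite (@los_term (fun n k i => R i n k)) //.
  split=> [[_]|h]; first by apply: ae_mono => i; rewrite pr_args.
  split; last by apply: ae_mono h => i; rewrite pr_args.
  by apply/alls_tnth => k; rewrite tnth_map; exact: De.
- rewrite !(@los_term (fun n k i => R i n k)) //.
  have XD m (t' : rterm m) i u : teval (pr i \o e) (R i) t' u -> alls (hdom (M i)) u.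
    by apply: (@Ri_dom (fun n k i => R i n k)) ; exact: hR'.
  split=> [E|h].
    have /seteqP[/(internal_sub _ (XD _ t)) h1 /(internal_sub _ (XD _ s)) h2] := E.
    by apply: ae_mono ((ae_and _ _).2 (conj h1 h2)) => i [? ?]; exact/seteqP.
  apply/seteqP; split; apply/internal_sub; try exact: XD;
    by apply: ae_mono h => i ->.
- rewrite !(@los_term (fun n k i => R i n k)) //.
  apply: internal_sub => i u; apply: (@Ri_dom (fun n k i => R i n k)) ; exact: hR'.
- by rewrite IH // ae_not.
- by rewrite IHp // IHq // ae_and.
- split=> [[a Da]|h].
    rewrite IH //; last exact: scons_in.
    by apply: ae_mono => i; rewrite pr_scons => h; exists (a i) => //; case: Da.
  have [i|f hf] := @dependent_choice _ _ (fun i a => hdom (M i) a /\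
    ((exists2 a, hdom (M i) a & sat (M i) (scons a (pr i \o e)) (R i) p) ->
      sat (M i) (scons a (pr i \o e)) (R i) p)).
    have [[a Da ha]|nex] := pselect (exists2 a, hdom (M i) a &
      sat (M i) (scons a (pr i \o e)) (R i) p); first by exists a.
    by have [d hd] := hdom_nonempty (M i); exists d.
  have [|a Da aE] := @lift_dom f; first by apply: ae_all => i; have [] := hf i.
  exists a => //; apply/IH => //; first exact: scons_in.
  apply: ae_mono ((ae_and _ _).2 (conj aE h)) => i [aEi hi]; rewrite pr_scons aEi.
  by have [_] := hf i; exact.
- have raddE (X : forall i, set (n.+1.-tuple (U i))) :
    radd n (internal X) (internal_rel R) = internal_rel (fun i => radd n (X i) (R i)).
    apply/esym/radd_eq; rewrite /internal_rel.
    + by congr internal; apply: functional_extensionality_dep => i; exact: radd_0.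
    + by move=> k; congr internal; apply: functional_extensionality_dep => i; exact: radd_S.
    + move=> m k nm; congr internal; apply: functional_extensionality_dep => i.
      exact: radd_neq.
  have radd_in (X : forall i, set (n.+1.-tuple (U i))) :
    (forall i, hrel (M i) n (X i)) -> rfamily_in (fun i => radd n (X i) (R i)).
    move=> HX i m k; have [<-|nm] := eqVneq n m; last first.
      rewrite radd_neq //.
    by case: k => [|k]; rewrite ?radd_0 ?radd_S.
  split=> [[Y [X HX ->]]|h].
    rewrite raddE IH //; last exact: radd_in.
    by apply: ae_mono => i ?; exists (X i).
  have [i|X hX] := @dependent_choice _ _ (fun i Y => hrel (M i) n Y /\
    ((exists2 Y, hrel (M i) n Y & sat (M i) (pr i \o e) (radd n Y (R i)) p) ->
      sat (M i) (pr i \o e) (radd n Y (R i)) p)).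
    have [[Y HY hY]|nex] := pselect (exists2 Y, hrel (M i) n Y &
      sat (M i) (pr i \o e) (radd n Y (R i)) p); first by exists Y.
    by have [Y hY] := hrel_nonempty (M i) n; exists Y.
  have HX i : hrel (M i) n (X i) by have [] := hX i.
  exists (internal X); first by exists X.
  rewrite raddE; apply/IH => //; first exact: radd_in.
  by apply: ae_mono h => i; have [_] := hX i.
Qed.

Lemma internal_assignment e r : assignment_in ultraproduct e r ->
  exists2 R, rfamily_in R & r = internal_rel R.
Proof.
move=> [_ hr].
have [nk|f hf] := @dependent_choice (nat * nat) (fun nk => forall i, set (nk.1.+1.-tuple (U i)))
  (fun nk X => (forall i, hrel (M i) nk.1 (X i)) /\ r nk.1 nk.2 = internal X).
  by have [X HX E] := hr nk.1 nk.2; exists X.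
exists (fun i n k => f (n, k) i) => [i n k|]; first by have [] := hf (n, k).
by apply: rassignment_ext => n k; have [] := hf (n, k).
Qed.

Lemma ultraproduct_is_model T : (forall i, is_model (M i) T) -> is_model ultraproduct T.
Proof.
move=> hM phi Tphi e r her; have [De _] := her.
have [R hR ->] := internal_assignment her.
apply/los => //; apply: ae_all => i; apply: hM => //; split=> // x.
by have [] := De x.
Qed.

Lemma ultraproduct_saturated K (phi : nat -> formula) e R :
  (forall x, uhdom (e x)) -> rfamily_in R ->
  (forall N, exists q, [/\ size q = K, alls uhdom q
    & forall n, n < N -> sat ultraproduct (q ++> e) (internal_rel R) (phi n)]) ->
  exists q, [/\ size q = K, alls uhdom q
    & forall n, sat ultraproduct (q ++> e) (internal_rel R) (phi n)].
Proof.
move=> De hR h.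
pose A N i := exists q : K.-tuple (U i), alls (hdom (M i)) q /\
  forall n, n < N -> sat (M i) (q ++> pr i \o e) (R i) (phi n).
have hA N : W (A N).
  have [q [/eqP sq Dq hq]] := h N.
  have : W (fun i => forall n : 'I_N, sat (M i) (map (pr i) q ++> pr i \o e) (R i) (phi n)).
    apply: (@filter_forall nat 'I_N (fun n => [set i | sat (M i) (map (pr i) q ++> pr i \o e) (R i) (phi n)]) W FW).
    move=> n; have /los hn := hq n (ltn_ord n).
    by apply: ae_mono (hn (env_in Dq De) hR) => i; rewrite pr_env.
  apply: ae_mono => i hi; exists (map_tuple (pr i) (Tuple sq)); split; first exact: alls_pr.
  by move=> n nN; exact: (hi (Ordinal nN)).
(* In component [i] the tuple satisfies the longest satisfiable initial segment of length at most
   [i]. Almost every component is late enough and satisfies a given segment. *)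
have [i|a ha] := @dependent_choice _ _ (fun i (q : K.-tuple (U i)) => alls (hdom (M i)) q /\
  forall N, N <= i -> A N i -> forall n, n < N -> sat (M i) (q ++> pr i \o e) (R i) (phi n)).
  suff H B : exists q : K.-tuple (U i), alls (hdom (M i)) q /\
    forall N, N <= B -> A N i -> forall n, n < N -> sat (M i) (q ++> pr i \o e) (R i) (phi n).
    exact: H.
  elim: B => [|B [q [Dq hq]]].
    have [d hd] := hdom_nonempty (M i); exists [tuple d | _ < K]; split; last by move=> [].
    by apply/alls_tnth => j; rewrite tnth_mktuple.
  have [[q' [Dq' hq']]|nA] := pselect (A B.+1 i).
    exists q'; split=> // N NB _ n nN; apply: hq'; exact: leq_trans nN NB.
  exists q; split=> // N; rewrite leq_eqVlt => /predU1P[->|]; last exact: hq.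
  by move=> /nA.
have [|q Dq qE] := @lift_tuple K a; first by apply: ae_all => i; have [] := ha i.
exists q; split=> //; first exact: size_tuple.
move=> n; apply/los => //; first exact: env_in.
have := (ae_and _ _).2 (conj qE ((ae_and _ _).2 (conj (hA n.+1) (W_cofinite n.+1)))).
apply: ae_mono => i [qEi [Ai ni]]; rewrite pr_env.
rewrite -[map (pr i) q]/(tval (map_tuple (pr i) q)) qEi.
by have [_ H] := ha i; apply: (H n.+1).
Qed.

End Ultraproduct.

(** * The structure on the field of the first arguments *)

Lemma first_order_relativize X phi : first_order phi -> first_order (relativize X phi).
Proof.
elim: phi X => //= [p IHp q IHq X /andP[/IHp -> /IHq ->]//|p IH X /IH -> //].
Qed.

Lemma sat_comprehension U (M : henkin U) e r n phi :
  sat M e r (FEx2 n (FAlls n.+1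
    (FIff (FRel (RVar n 0) (ivars n.+1)) (fsubst (lift2 n) phi)))) ->
  exists2 Y, hrel M n Y & forall s : n.+1.-tuple U, alls (hdom M) s ->
    Y s <-> sat M (s ++> e) r phi.
Proof.
move=> [Y HY h]; exists Y => // s Ds.
have := (sat_alls M n.+1 e (radd n Y r) _).1 h s (size_tuple s) Ds.
by rewrite sat_iff sat_lift2 /= radd_0 map_ivars.
Qed.

Section Bounded.
Variables Rs Rs' : seq rvar.

(** Undisplayed relation variables are read as empty, in accordance with [bounded_struct]; so every
    sentence of [fo] yields a formula with admissible free variables. *)
Fixpoint embed (phi : fo) : formula :=
  match phi with
  | FoEq x y => FEq x y
  | FoLe x y => FLe x y
  | FoRel n i xs => FRel (if (n, i) \in Rs ++ Rs' then RVar n i else REmpty n) xs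
  | FoNot p => FNot (embed p)
  | FoAnd p q => FAnd (embed p) (embed q)
  | FoEx p => FEx1 (embed p)
  end.

Definition bounded phi := relativize (field_of Rs) (embed phi).

Lemma embed_first_order phi : first_order (embed phi).
Proof. by elim: phi => //= p -> q ->. Qed.

Lemma free2_embed v phi : free2 v (embed phi) -> v \in Rs ++ Rs'.
Proof.
elim: phi => //= [n i xs|p IHp q IHq /orP[/IHp|/IHq] //].
by case: ifP => //= vs /eqP ->.
Qed.

Lemma free1_embed x phi : free1 x (embed phi) -> x < fbound phi.
Proof.
elim: phi x => //= [y z x|y z x|n i xs x|p IHp q IHq x|p IH x].
- by move=> /orP[] /eqP ->; rewrite leq_max leqnn ?orbT.
- by move=> /orP[] /eqP ->; rewrite leq_max leqnn ?orbT.
- case/orP; first by case: ifP.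
  by move=> /tnthP[k ->]; exact: (@leq_bigmax _ (fun k => (tnth xs k).+1)).
- by move=> /orP[/IHp|/IHq] h; rewrite leq_max h ?orbT.
- by move=> /IH; case: fbound.
Qed.

Lemma embed_displayed phi : fbound phi = 0 -> displayed (Rs ++ Rs') (embed phi).
Proof.
move=> h; split=> [x|v]; last exact: free2_embed.
by apply/negP => /free1_embed; rewrite h.
Qed.

Lemma tfree1_field x : tfree1 x (field_of Rs) = false.
Proof. by elim: Rs. Qed.

Lemma tren1_field rho : tren1 rho (field_of Rs) = field_of Rs.
Proof. by elim: Rs => //= v s ->. Qed.

Lemma free1_bounded x phi : free1 x (bounded phi) -> x < fbound phi.
Proof.
rewrite /bounded; elim: phi x => //= [y z x|y z x|n i xs x|p IHp q IHq x|p IH x].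
- exact: (@free1_embed x (FoEq y z)).
- exact: (@free1_embed x (FoLe y z)).
- exact: (@free1_embed x (FoRel i xs)).
- by move=> /orP[/IHp|/IHq] h; rewrite leq_max h ?orbT.
- by rewrite tren1_field tfree1_field inE /= => /IH; case: fbound.
Qed.

Section Models.
Variable U : Type.
Implicit Types (M : henkin U) (e : nat -> U) (r : rassignment U).

Definition fieldset r : set U :=
  [set a | exists2 v, v \in Rs & exists i, exists2 u, r v.1 v.2 u & a = tnth u i].

Lemma teval_field e r u : teval e r (field_of Rs) u <-> fieldset r (thead u).
Proof.
rewrite /fieldset /=; elim: Rs => [|v s IH] /=; first by split=> [|[]].
split=> [[[i [a ra ua]]|/IH[w ws h]]|[w]].
- by exists v; rewrite ?mem_head //; exists i, a.
- by exists w => //; rewrite inE ws orbT.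
- rewrite inE => /predU1P[->|ws] h; last by right; apply/IH; exists w.
  by left; case: h => i [a ra ua]; exists i, a.
Qed.

Lemma fieldset_hdom M e r : assignment_in M e r -> fieldset r `<=` hdom M.
Proof. by move=> [_ hr] a [v _ [i [u ru ->]]]; exact: hrel_sub (hr _ _) _ ru _. Qed.

Definition bounded_struct M r (h : fieldset r !=set0) : fstruct :=
  @FStruct U (fieldset r) (hle M)
    (fun n i => if (n, i) \in Rs ++ Rs' then r n i else set0) h.

Lemma sat_bounded M e0 r (h : fieldset r !=set0) phi e : assignment_in M e0 r ->
  @fsat (bounded_struct M h) phi e <-> sat M e r (bounded phi).
Proof.
rewrite /bounded => hr; elim: phi e => //= [n i xs e|p IH e|p IHp q IHq e|p IH e].
- by case: ifP => _; split.
- by rewrite IH.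
- by rewrite IHp IHq.
- rewrite tren1_field; split=> -[a Da].
    move=> /IH ha; exists a; first exact: (fieldset_hdom hr).
    by split=> //; apply/teval_field; rewrite /thead tnth_map.
  move=> [/teval_field]; rewrite /thead tnth_map => Fa /IH ha.
  by exists a.
Qed.

(** The guard that keeps tuples inside the field, for comprehension in [M] and for realising
    types. *)
Fixpoint field_vars n :=
  if n is m.+1 then FAnd (FRel (field_of Rs) [tuple m]) (field_vars m) else FNot (FNot (FEq 0 0)).

Lemma sat_field_vars M e r n :
  sat M e r (field_vars n) <-> forall i, i < n -> fieldset r (e i).
Proof.
elim: n => [|n IH] /=; first by split=> // _; apply.
rewrite IH; split=> [[/teval_field h1 h2] i|h].
  by rewrite ltnS leq_eqVlt => /predU1P[->|/h2//]; move: h1; rewrite /thead tnth_map.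
split=> [|i ni]; last by apply: h; exact: ltnW.
by apply/teval_field; rewrite /thead tnth_map; exact: h.
Qed.

Lemma field_vars_env M e r s :
  sat M (s ++> e) r (field_vars (size s)) <-> alls (fieldset r) s.
Proof.
rewrite sat_field_vars alls_nth; split=> h.
  by move=> d x xs; rewrite -(env_lt d e xs); exact: h.
by move=> i si; rewrite (env_lt (e 0)) //; exact: h.
Qed.

Lemma first_order_field_vars n : first_order (field_vars n).
Proof. by elim: n. Qed.

(** * The definable model as a substructure of the given one *)

Section Definable.
Variables (M : henkin U) (e0 : nat -> U) (r : rassignment U).
Hypotheses (MT : is_model M Sigma11_AC0_wo) (hr : assignment_in M e0 r).
Hypothesis Fne : fieldset r !=set0.
Let S := bounded_struct M Fne.

(** Comprehension in [M] applies to the relativised formula together with the guard, which makes the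
    definable relation a relation of [M]. *)
Lemma definable_hrel n psi (p : nat -> fU S) : (forall x, fD S (p x)) ->
  hrel M n (fset psi p).
Proof.
move=> Dp.
have hp : assignment_in M p r.
  by split=> [x|]; [apply: (fieldset_hdom hr); exact: Dp|case: hr].
have ffo : first_order (FAnd (field_vars n.+1) (bounded psi)).
  by rewrite /= first_order_field_vars first_order_relativize ?embed_first_order.
have [Y HY YE] := sat_comprehension (MT (ax_comprehension n ffo) hp).
rewrite (_ : fset psi p = Y) //.
have E (s : n.+1.-tuple U) : alls (hdom M) s -> Y s <-> fset psi p s.
  move=> Ds; have V := field_vars_env M p r s; rewrite size_tuple in V.
  rewrite YE // -[sat _ _ _ _]/(sat M (s ++> p) r (field_vars n.+1) /\ sat M (s ++> p) r (bounded psi)).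
  by rewrite V -(sat_bounded Fne psi _ hr).
apply/seteqP; split=> s.
  move=> hs; apply/E => //; apply/alls_tnth => i; apply: (fieldset_hdom hr).
  by have [/alls_tnth Fs _] := hs; exact: Fs.
move=> Ys; apply/E => //; apply/alls_tnth; exact: hrel_sub HY _ Ys.
Qed.

(** Definable sets are relations of [M], so the axiom on least elements in [M] applies to them. *)
Lemma bounded_well_ordered : well_ordered S.
Proof.
have FD a : fD S a -> hdom M a by exact: (fieldset_hdom hr).
have H phi : Sigma11_AC0_wo phi -> sat M e0 r phi by move=> /MT; exact.
split.
- by move=> x /FD Dx; have /sat_all1/(_ x Dx) := H _ ax_le_refl.
- move=> x y /FD Dx /FD Dy xy yx.
  have /sat_all1/(_ x Dx)/sat_all1/(_ y Dy)/sat_imp := H _ ax_le_antisym.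
  by apply.
- move=> x y z /FD Dx /FD Dy /FD Dz xy yz.
  have /sat_all1/(_ x Dx)/sat_all1/(_ y Dy)/sat_all1/(_ z Dz)/sat_imp := H _ ax_le_trans.
  by apply.
- move=> x y /FD Dx /FD Dy nxy.
  have /sat_all1/(_ x Dx)/sat_all1/(_ y Dy)/sat_imp := H _ ax_le_total.
  by apply.
move=> psi p Dp [a Da ha].
have E (b : U) : radd 0 (fset (S := S) psi p) r 0 0 [tuple b] <-> fD S b /\ @fsat S psi (scons b p).
  by rewrite (radd_0 (fset (S := S) psi p) r) /fset /=; tauto.
have tE (b : U) (e' : nat -> U) : map_tuple (scons b e') [tuple 0] = [tuple b].
  by apply: val_inj.
have /sat_all2/(_ _ (@definable_hrel 0 psi p Dp))/sat_imp := H _ ax_le_least.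
move=> [|b Db [hb hmin]].
  by exists a; [exact: FD|rewrite /= tE; apply/E].
move: hb; rewrite /= tE => /E[Fb hb]; exists b; split=> // c Dc hc.
apply: contrapT => nbc; apply: hmin; exists c; first exact: FD.
by apply; split=> //=; rewrite tE; apply/E.
Qed.

Lemma defmodel_substructure : substructure (defmodel S) M.
Proof.
split; first exact: (fieldset_hdom hr).
  by move=> n X [psi [p [Dp ->]]]; exact: definable_hrel.
by move=> x y; split=> [[? ? ?]|[]].
Qed.

(** [drel] cuts these relations down to the field of [Rs]. *)
Definition display_defs n i : fo :=
  if (n, i) \in Rs ++ Rs' then FoRel i (ivars n.+1) else FoNot (FoEq 0 0).

Lemma drel_display (p : nat -> fU S) (n i : nat) : (n, i) \in Rs ++ Rs' ->
  @drel S display_defs p n i = [set u : n.+1.-tuple U | alls (fieldset r) u /\ @r n i u].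
Proof.
rewrite /drel /display_defs => vin; rewrite vin.
by apply/seteqP; split=> u; rewrite /fset /= map_ivars vin.
Qed.

(** Conservativity cuts [Rs'] down to the field, and the relations in [Rs] lie over it anyway. The
    arguments then belong to the small model, to which domain independence transfers [Q]. *)
Lemma quantifier_defmodel Q (p : nat -> fU S) :
  generalized_quantifier Rs Rs' Q ->
  henkin_domain_independent Sigma11_AC0_wo Q ->
  henkin_conservative Sigma11_AC0_wo Rs Rs' Q ->
  saturated S -> (forall x, fD S (p x)) ->
  sat M e0 r Q <-> sat (defmodel S) p (drel display_defs p) Q.
Proof.
move=> [_ _ _ [Q1 Q2]] hind hcons satS Dp.
have /sat_iff -> := hcons _ _ MT _ _ hr.
have -> := hind _ _ _ (defmodel_is_model satS bounded_well_ordered) MT defmodel_substructure p.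
  rewrite sat_subst; apply: sat_coin => [x|[n i] /Q2 /= vin]; first by rewrite (negPf (Q1 x)).
  rewrite drel_display // /bound_by_field; case: ifP => [_|nvin] /=.
    apply/seteqP; split=> u [h ru]; split=> //.
      by apply/alls_tnth => k; have /teval_field := h k.
    by move=> k; apply/teval_field; move/alls_tnth: h; exact.
  apply/seteqP; split=> u => [ru|[] //]; split=> //.
  apply/alls_tnth => k; exists (n, i); last by exists k, u.
  by move: vin; rewrite mem_cat nvin orbF.
split=> // n i; exists (display_defs n i), p; split=> //.
Qed.

End Definable.
End Models.
End Bounded.

(** * Compactness *)

(** An enumeration of the sentences, in which all other codes stand for a sentence true in every
    structure. *)
Definition closed_code k : fo :=
  if unpickle k is Some phi then if fbound phi == 0 then phi else FoEx (FoEq 0 0)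
  else FoEx (FoEq 0 0).

Lemma closed_codeP k : fbound (closed_code k) = 0.
Proof. by rewrite /closed_code; case: unpickle => // phi; case: eqP. Qed.

Lemma closed_code_pickle phi : fbound phi = 0 -> closed_code (pickle phi) = phi.
Proof. by move=> h; rewrite /closed_code pickleK h eqxx. Qed.

Section Instances.
Variables Rs Rs' : seq rvar.

(** Models with arguments, restricted to a non-empty field so that [bounded_struct] exists. *)
Record inst := Inst {
  iU : Type;
  iM : henkin iU;
  ie : nat -> iU;
  ir : rassignment iU;
  iT : is_model iM Sigma11_AC0_wo;
  iA : assignment_in iM ie ir;
  iF : fieldset Rs ir !=set0
}.

Definition isat (I : inst) phi := sat (iM I) (ie I) (@ir I) phi.

Definition istruct (I : inst) : fstruct := bounded_struct Rs' (iM I) (@iF I).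

Lemma isat_closed (I : inst) phi (p : nat -> fU (istruct I)) : fbound phi = 0 ->
  isat I (bounded Rs Rs' phi) <-> fsat phi p.
Proof.
move=> h; rewrite (sat_bounded Rs' (iF I) phi p (iA I)).
by apply: sat_coin => // x /free1_bounded; rewrite h.
Qed.

(** The ultraproduct of the instances. That the field is non-empty is a sentence, and saturation
    passes to the structure on the field because relativisation expresses its formulas in the
    ultraproduct. *)
Lemma limit_instance (W : set_system nat) (I : nat -> inst) : UltraFilter W ->
  (forall N, W [set n | N <= n]) ->
  exists J : inst, saturated (istruct J) /\
    forall phi, (forall x, ~~ free1 x phi) -> isat J phi <-> W (fun i => isat (I i) phi).
Proof.
move=> UW Wcof.
pose M i := iM (I i).
pose P := ultraproduct UW M.
have [d Dd] := hdom_nonempty P.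
pose e := fun _ : nat => d.
pose R i := @ir (I i).
have De x : uhdom W M (e x) by [].
have hR : rfamily_in M R by move=> i n k; have [_] := @iA (I i); exact.
pose r := internal_rel W M R.
have hr : assignment_in P e r by split=> // n k; exists (fun i => R i n k).
have PT : is_model P Sigma11_AC0_wo by apply: ultraproduct_is_model => i; exact: iT.
have losP phi : (forall x, ~~ free1 x phi) -> sat P e r phi <-> W (fun i => isat (I i) phi).
  move=> nf; rewrite (los UW phi De hR).
  apply: (ae_iff UW); apply: (ae_all UW) => i; apply: sat_coin => // x xf.
  by rewrite (negPf (nf x)) in xf.
have Fne : fieldset Rs r !=set0.
  have [a Da /teval_field] : sat P e r (FEx1 (FRel (field_of Rs) [tuple 0])).
    apply/losP => [x|]; first by rewrite /= tfree1_field inE.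
    apply: (ae_all UW) => i; have [a Fa] := iF (I i).
    exists a; first exact: (fieldset_hdom (iA (I i)) Fa).
    by apply/teval_field; rewrite /thead tnth_map.
  by rewrite /thead tnth_map; exists a.
exists (Inst PT hr Fne); split; last exact: losP.
move=> K phi p Dp hN.
have Dp' x : uhdom W M (p x) by exact: (fieldset_hdom hr (Dp x)).
pose psi n := FAnd (field_vars Rs K) (bounded Rs Rs' (phi n)).
have psiE q n : size q = K -> sat P (q ++> p) r (psi n) <->
    alls (fieldset Rs r) q /\ @fsat (bounded_struct Rs' P Fne) (phi n) (q ++> p).
  move=> sq; rewrite (sat_bounded Rs' Fne (phi n) _ hr) -(field_vars_env Rs P p r q) sq.
  by [].
have [N|q [sq Dq hq]] := @ultraproduct_saturated W UW Wcof _ M K psi p R Dp' hR.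
  have [q [sq Dq hq]] := hN N; exists q; split=> //.
    by apply/alls_nth => x y yq; move/alls_nth: Dq => Dq; exact: (fieldset_hdom hr (Dq x y yq)).
  by move=> n nN; apply/psiE => //; split=> //; exact: hq.
exists q; split=> //; first by have /psiE[] := hq 0.
by move=> n; have /psiE[] := hq n.
Qed.

Definition agree N (I J : inst) := forall k, k < N ->
  isat I (bounded Rs Rs' (closed_code k)) <-> isat J (bounded Rs Rs' (closed_code k)).

(** Such a property is a Boolean combination of the first [N] sentences; the induction splits on the
    truth value of the last one. *)
Lemma finite_invariant_definable N (q : inst -> Prop) :
  (forall I J, agree N I J -> q I -> q J) ->
  exists phi, fbound phi = 0 /\ forall I, q I <-> isat I (bounded Rs Rs' phi).
Proof.
elim: N q => [|N IH] q hq.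
  have T I : isat I (bounded Rs Rs' (FoEx (FoEq 0 0))).
    have [a Fa] := @iF I; apply/(isat_closed (fun=> a)) => //.
    by exists a.
  have [[I0 q0]|nq] := pselect (exists I, q I).
    exists (FoEx (FoEq 0 0)); split=> // I; split=> // _.
    exact: hq q0.
  exists (FoNot (FoEx (FoEq 0 0))); split=> // I; split=> [qI|nT]; first by case: nq; exists I.
  by case: nT; exact: T.
pose B I b := isat I (bounded Rs Rs' (closed_code N)) <-> b.
(* Changing the truth value of sentence [N] to [b] by passing to another instance makes the property
   invariant under the earlier sentences alone. *)
pose q' b I := exists J, [/\ agree N I J, B J b & q J].
have hq' b I J : agree N I J -> q' b I -> q' b J.
  move=> IJ [J' [IJ' Bb qJ']]; exists J'; split=> // k kN.
  by rewrite -(IJ k kN); exact: IJ'.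
have [f1 [b1 h1]] := IH (q' True) (hq' True).
have [f0 [b0 h0]] := IH (q' False) (hq' False).
exists (FoAnd (FoNot (FoAnd (closed_code N) (FoNot f1)))
  (FoNot (FoAnd (FoNot (closed_code N)) (FoNot f0)))); split.
  by rewrite /= closed_codeP b1 b0.
have key I b : B I b -> q I <-> q' b I.
  move=> Bb; split=> [qI|[J [IJ BJ qJ]]]; first by exists I.
  apply: hq qJ => k; rewrite ltnS leq_eqVlt => /predU1P[->|kN].
    exact: iff_trans BJ (iff_sym Bb).
  exact: iff_sym (IJ k kN).
move=> I.
suff : q I <-> ~ (isat I (bounded Rs Rs' (closed_code N)) /\ ~ isat I (bounded Rs Rs' f1)) /\
  ~ (~ isat I (bounded Rs Rs' (closed_code N)) /\ ~ isat I (bounded Rs Rs' f0)) by [].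
rewrite -h1 -h0.
have [hc|nc] := pselect (isat I (bounded Rs Rs' (closed_code N))).
  have /key -> : B I True by split.
  split=> [h|[h _]]; first by split=> -[].
  by apply: contrapT => nh; apply: h.
have /key -> : B I False by split.
split=> [h|[_ h]]; first by split=> -[].
by apply: contrapT => nh; apply: h.
Qed.

Lemma saturated_instances_agree (Q : formula) (I J : inst) :
  generalized_quantifier Rs Rs' Q ->
  henkin_domain_independent Sigma11_AC0_wo Q ->
  henkin_conservative Sigma11_AC0_wo Rs Rs' Q ->
  saturated (istruct I) -> saturated (istruct J) ->
  (forall phi, fbound phi = 0 -> isat I (bounded Rs Rs' phi) <-> isat J (bounded Rs Rs' phi)) ->
  isat I Q -> isat J Q.
Proof.
move=> hQ hind hcons satI satJ IJ.
have [a Fa] := @iF I; have [b0 Fb0] := @iF J.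
pose p : nat -> fU (istruct I) := fun=> a.
(* Sentences alone do not provide matching assignments. [G] is the type of [a], with all variables
   identified; a realisation [b] makes the two constant assignments equivalent. *)
pose G phi := exists psi, phi = fren (fun=> 0) psi /\ fsat psi p.
have [|q [sq Dq hq]] := @saturated_set (istruct J) 1 G (fun=> b0) satJ (fun=> Fb0).
  move=> l lG.
  have [g hg] := fo_conjunction l.
  pose s := FoEx (fren (fun=> 0) g).
  have bs : fbound s = 0 by rewrite /=; case: fbound (fbound_ren0 g) => [|[]].
  have : fsat s p.
    exists a => //; apply/fsat_ren; apply/hg => psi /lG[psi' [-> h]].
    exact/fsat_ren.
  move=> /(isat_closed p bs)/(IJ s bs)/(isat_closed (fun=> b0) bs)[b Fb /fsat_ren/hg hb].
  exists [:: b]; split=> // psi pl; have [psi' [E _]] := lG _ pl.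
  by move: (hb _ pl); rewrite E !fsat_ren.
case: q sq Dq hq => [|b [|? ?]] // _ [Fb _] hq.
have eqv : @fo_equiv (istruct I) (istruct J) p (fun=> b).
  have h phi : fsat phi p -> @fsat (istruct J) phi (fun=> b).
    move=> hphi; have : G (fren (fun=> 0) phi) by exists phi.
    by move=> /hq/fsat_ren.
  move=> phi; split=> [|h']; first exact: h.
  by apply: contrapT => np; exact: (h (FoNot phi) np).
rewrite /isat (quantifier_defmodel (@iT I) (@iA I) (Fne := @iF I) hQ hind hcons satI (p := p)) //.
rewrite (quantifier_defmodel (@iT J) (@iA J) (Fne := @iF J) hQ hind hcons satJ (p := fun=> b)) //.
exact: (@back_and_forth Q _ _ p (fun=> b) id).
Qed.

End Instances.

Theorem theorem11p3 (Q : formula) (Rs Rs' : seq rvar)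
    (hQ : generalized_quantifier Rs Rs' Q)
    (hind : henkin_domain_independent Sigma11_AC0_wo Q)
    (hcons : henkin_conservative Sigma11_AC0_wo Rs Rs' Q)
    (himp : strong_existential_import Sigma11_AC0_wo Rs Q) :
  bounded_first_order_definable Sigma11_AC0_wo Rs Rs' Q.
Proof.
have [_ _ _ [Q1 _]] := hQ.
have [N hN] : exists N, forall I J : inst Rs, agree Rs' N I J -> isat I Q -> isat J Q.
  apply: contrapT => nN.
  have /choice[IJ hIJ] : forall N, exists IJ : inst Rs * inst Rs,
      [/\ agree Rs' N IJ.1 IJ.2, isat IJ.1 Q & ~ isat IJ.2 Q].
    move=> N; apply: contrapT => nIJ; apply: nN; exists N => I J aIJ QI.
    by apply: contrapT => nQJ; apply: nIJ; exists (I, J).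
  (* Both sequences use the same ultrafilter: the sentence with code [k] is compared by all pairs of
     index above [k], hence by almost all pairs. *)
  have [W [UW Wcof']] := ultraFilterLemma (eventually_filter).
  have Wcof M : W [set n | M <= n] by apply: Wcof'; exists M.
  have [I [satI hI]] := limit_instance Rs' (fun n => (IJ n).1) UW Wcof.
  have [J [satJ hJ]] := limit_instance Rs' (fun n => (IJ n).2) UW Wcof.
  have QI : isat I Q by apply/hI => //; apply: (ae_all UW) => n; have [] := hIJ n.
  have : isat J Q.
    apply: (saturated_instances_agree hQ hind hcons satI satJ) QI => phi b0.
    have nf x : ~~ free1 x (bounded Rs Rs' phi) by apply/negP => /free1_bounded; rewrite b0.
    rewrite hI // hJ //; apply: (ae_iff UW).
    apply: (ae_mono UW) (Wcof (pickle phi).+1) => n kn.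
    have [h _ _] := hIJ n; have := h _ kn.
    by rewrite closed_code_pickle.
  move=> /(hJ _ Q1).
  by apply: (ae_not UW _).1; apply: (ae_all UW) => n; have [] := hIJ n.
have [phi [b0 hphi]] := finite_invariant_definable hN.
(* [phi] describes [Q] only over a non-empty field. The first conjunct is false for an empty field,
   where [Q] fails by existential import. *)
pose phi' := FoAnd (FoEx (FoEq 0 0)) phi.
exists (embed Rs Rs' phi'); split.
- exact: embed_first_order.
- by apply: embed_displayed; rewrite /= b0.
move=> U M MT e r hr; apply/sat_iff; split=> [hq|].
  have Fne : fieldset Rs r !=set0.
    have /sat_imp/(_ hq) := himp _ _ MT _ _ hr.
    apply: contra_notP => nF /=; apply/seteqP; split=> // u /teval_field Fu.
    by case: nF; exists (thead u).
  split; last exact: (hphi (Inst MT hr Fne)).1.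
  have [a Fa] := Fne; exists a; first exact: (fieldset_hdom hr Fa).
  split=> //; rewrite tren1_field; apply/teval_field.
  by rewrite /thead tnth_map.
move=> [[a _ []]]; rewrite tren1_field => /teval_field; rewrite /thead tnth_map => Fa _ h.
by apply/(hphi (Inst MT hr (ex_intro _ a Fa))).
Qed.
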